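(* (GBC) For any class $A$ and any uncountable cardinal $\kappa$, if there is a truth predicate for the infinitary language $\mathcal L_{\kappa,\omega}(\in,\hat A)$, then there is a $\kappa$-iterated truth predicate in the first-order language $\mathcal L_{\omega,\omega}(\in,\hat{\mathrm{Tr}},\hat A)$.
   Context: $\mathcal L_{\kappa,\omega}(\in,\hat A)$: formulas built from $x=y$, $x\in y$, $x\in\hat A$ by negation, conjunctions of fewer than $\kappa$ formulas with finitely many free variables in total, and universal quantifiers. A truth predicate for it is a class $\mathbb T$ of pairs $\langle\varphi,\vec a\rangle$ ($\vec a$ a valuation) with: atomic formulas judged correctly ($a=b$, $a\in b$, $a\in A$); $\mathbb T(\bigwedge_i\varphi_i,\vec a)$ iff all $\mathbb T(\varphi_i,\vec a)$; $\mathbb T(\neg\varphi,\vec a)$ iff not $\mathbb T(\varphi,\vec a)$; $\mathbb T(\forall x\varphi,\vec a)$ iff $\mathbb T(\varphi,b^\frown\vec a)$ for all $b$. $\mathcal L_{\omega,\omega}(\in,\hat{\mathrm{Tr}},\hat A)$ is the first-order language with $\in$, $\hat A$, and a ternary predicate $\hat{\mathrm{Tr}}$. A $\kappa$-iterated truth predicate is a class $\mathrm{Tr}$ of triples $\langle\beta,\varphi,\vec a\rangle$ with $\beta<\kappa$, $\varphi$ in this language, $\vec a$ a valuation, such that for all $\beta<\kappa$: atomic $\{=,\in,\hat A\}$ formulas judged correctly; $\mathrm{Tr}(\beta,\hat{\mathrm{Tr}}(x,y,z),\langle\alpha,\varphi,\vec a\rangle)$ iff $\alpha<\beta$ and $\mathrm{Tr}(\alpha,\varphi,\vec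 a)$; $\mathrm{Tr}(\beta,\varphi\wedge\psi,\vec a)$ iff both hold; $\mathrm{Tr}(\beta,\neg\varphi,\vec a)$ iff not $\mathrm{Tr}(\beta,\varphi,\vec a)$; $\mathrm{Tr}(\beta,\forall x\varphi,\vec a)$ iff $\mathrm{Tr}(\beta,\varphi,b^\frown\vec a)$ for all $b$. *)

(* Defs.v *)
From Stdlib Require Import ClassicalEpsilon.

Set Implicit Arguments.
Unset Strict Implicit.
Unset Printing Implicit Defensive.

(** * Models of Gödel-Bernays set theory with global choice *)

Record gb_structure := {
  sets : Type;
  classes : Type;
  mem : sets -> sets -> Prop;
  cmem : sets -> classes -> Prop
}.

Reserved Notation "x ∈ y" (at level 70, no associativity).
Reserved Notation "x ∈c X" (at level 70, no associativity).

(** The formulas allowed in class comprehension: set variables (de Bruijn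
    indices) may be quantified, class variables occur only as parameters. *)
Inductive pfml : Type :=
| PEq (i j : nat)
| PMem (i j : nat)
| PCls (i k : nat)
| PNeg (f : pfml)
| PAnd (f g : pfml)
| PAll (f : pfml).

Definition scons (T : Type) (x : T) (e : nat -> T) (n : nat) : T :=
  match n with O => x | S m => e m end.

Section Theory.
Variable M : gb_structure.
Local Notation "x ∈ y" := (mem (g := M) x y).
Local Notation "x ∈c X" := (cmem (g := M) x X).

Fixpoint psat (X : nat -> classes M) (e : nat -> sets M) (f : pfml) : Prop :=
  match f with
  | PEq i j => e i = e j
  | PMem i j => e i ∈ e j
  | PCls i k => e i ∈c X k
  | PNeg g => ~ psat X e g
  | PAnd g h => psat X e g /\ psat X e h
  | PAll g => forall x : sets M, psat X (scons x e) g
  end.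

Definition is_empty (z : sets M) := forall w, ~ w ∈ z.
Definition is_upair (z x y : sets M) := forall w, w ∈ z <-> w = x \/ w = y.
Definition is_opair (p x y : sets M) :=
  exists u v, is_upair u x x /\ is_upair v x y /\ is_upair p u v.
Definition is_succ (y x : sets M) := forall w, w ∈ y <-> w ∈ x \/ w = x.

Definition inductive_set (I : sets M) :=
  (exists e, is_empty e /\ e ∈ I) /\
  (forall x, x ∈ I -> exists y, is_succ y x /\ y ∈ I).

Definition functional_class (F : classes M) :=
  forall x y y' p p', is_opair p x y -> is_opair p' x y' ->
    p ∈c F -> p' ∈c F -> y = y'.

Record GBC : Prop := {
  gbc_set_ext : forall x y : sets M, (forall z, z ∈ x <-> z ∈ y) -> x = y;
  gbc_class_ext : forall X Y : classes M, (forall z, z ∈c X <-> z ∈c Y) -> X = Y;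
  gbc_pairing : forall x y, exists z, is_upair z x y;
  gbc_union : forall x, exists u, forall w, w ∈ u <-> exists y, y ∈ x /\ w ∈ y;
  gbc_power : forall x, exists u, forall w, w ∈ u <-> forall z, z ∈ w -> z ∈ x;
  gbc_infinity : exists I, inductive_set I;
  gbc_comprehension : forall (f : pfml) (X : nat -> classes M) (e : nat -> sets M),
    exists Y : classes M, forall x, x ∈c Y <-> psat X (scons x e) f;
  gbc_replacement : forall (F : classes M) (a : sets M), functional_class F ->
    exists b, forall y, y ∈ b <-> exists x p, x ∈ a /\ is_opair p x y /\ p ∈c F;
  gbc_foundation : forall X : classes M, (exists x, x ∈c X) ->
    exists x, x ∈c X /\ forall y, y ∈ x -> ~ y ∈c X;
  gbc_global_choice : exists F : classes M, functional_class F /\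
    forall x, (exists y, y ∈ x) ->
      exists y p, y ∈ x /\ is_opair p x y /\ p ∈c F
}.
End Theory.

Record gbc_model := {
  gbc_struct :> gb_structure;
  gbc_axioms : GBC gbc_struct
}.

Notation "x ∈ y" := (mem x y).
Notation "x ∈c X" := (cmem x X).

(** * Set theory inside a model *)

Section InModel.
Variable M : gbc_model.
Implicit Types x y z w u v a b d e f p s t i j l n κ β : sets M.
Implicit Types A T : classes M.

Lemma empty_exists : exists z : sets M, is_empty z.
Proof. destruct (gbc_infinity (gbc_axioms M)) as [I [[z [Hz _]] _]]; eauto. Qed.

Definition empty : sets M :=
  proj1_sig (constructive_indefinite_description _ empty_exists).

Lemma emptyP : is_empty empty.
Proof. exact (proj2_sig (constructive_indefinite_description _ empty_exists)). Qed.

Definition upair x y : sets M :=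
  proj1_sig (constructive_indefinite_description _
    (gbc_pairing (gbc_axioms M) x y)).

Lemma upairP x y : is_upair (upair x y) x y.
Proof.
exact (proj2_sig (constructive_indefinite_description _
  (gbc_pairing (gbc_axioms M) x y))).
Qed.

Definition opair x y : sets M := upair (upair x x) (upair x y).
Local Notation "⟨ x , y ⟩" := (opair x y) (at level 0).

Lemma opairP x y : is_opair (opair x y) x y.
Proof.
exists (upair x x), (upair x y); repeat split; apply upairP.
Qed.

Definition is_nat n := forall I : sets M, inductive_set I -> n ∈ I.

Definition is_omega w := forall n, n ∈ w <-> is_nat n.

Definition function_on f d :=
  (forall p, p ∈ f -> exists x y, x ∈ d /\ p = ⟨x, y⟩) /\
  (forall x, x ∈ d -> exists! y, ⟨x, y⟩ ∈ f).

Definition equinumerous x y :=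
  exists f, function_on f x /\
    (forall u v, ⟨u, v⟩ ∈ f -> v ∈ y) /\
    (forall v, v ∈ y -> exists! u, ⟨u, v⟩ ∈ f).

Definition finite x := exists n, is_nat n /\ equinumerous n x.

(** Well-foundedness of membership is the axiom of foundation. *)
Definition ordinal x :=
  (forall y, y ∈ x -> forall z, z ∈ y -> z ∈ x) /\
  (forall y z, y ∈ x -> z ∈ x -> y ∈ z \/ y = z \/ z ∈ y).

Definition cardinal κ :=
  ordinal κ /\ forall β, β ∈ κ -> ~ equinumerous β κ.

Definition uncountable_cardinal κ :=
  cardinal κ /\ exists w, is_omega w /\ w ∈ κ.

(** For a cardinal [κ]: [x] has fewer than [κ] elements. *)
Definition card_lt x κ := exists β, β ∈ κ /\ equinumerous β x.

(** * Codes of formulas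

    Formulas are sets of the model.  The variables are [x_i] for [i] a natural
    number of the model, and a code carries one of the tags below; only their
    being pairwise distinct matters. *)

Fixpoint tag (k : nat) : sets M :=
  match k with O => empty | S m => upair (tag m) (tag m) end.

Definition fEq i j := ⟨tag 0, ⟨i, j⟩⟩.
Definition fMem i j := ⟨tag 1, ⟨i, j⟩⟩.
Definition fIn i := ⟨tag 2, i⟩.
Definition fNeg (φ : sets M) := ⟨tag 3, φ⟩.
(** The conjunction of all members of the set [Φ]. *)
Definition fConj (Φ : sets M) := ⟨tag 4, Φ⟩.
Definition fAll i (φ : sets M) := ⟨tag 5, ⟨i, φ⟩⟩.
Definition fTr i j l := ⟨tag 6, ⟨i, ⟨j, l⟩⟩⟩.
Definition fAnd (φ ψ : sets M) := ⟨tag 7, ⟨φ, ψ⟩⟩.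

(** [inf_step κ P φ s]: [φ] arises by one formation rule of
    L_{κ,ω}(∈,Â), and has [s] as its set of free variables, from formulas
    whose free variable sets are recorded in the set [P] of pairs. *)
Inductive inf_step κ (P : sets M) : sets M -> sets M -> Prop :=
| inf_eq i j : is_nat i -> is_nat j ->
    inf_step κ P (fEq i j) (upair i j)
| inf_mem i j : is_nat i -> is_nat j ->
    inf_step κ P (fMem i j) (upair i j)
| inf_in i : is_nat i ->
    inf_step κ P (fIn i) (upair i i)
| inf_neg φ s : ⟨φ, s⟩ ∈ P ->
    inf_step κ P (fNeg φ) s
| inf_conj Φ s : card_lt Φ κ ->
    (forall φ, φ ∈ Φ -> exists t, ⟨φ, t⟩ ∈ P) ->
    (forall n, n ∈ s <-> exists φ t, φ ∈ Φ /\ ⟨φ, t⟩ ∈ P /\ n ∈ t) ->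
    finite s ->
    inf_step κ P (fConj Φ) s
| inf_all i φ s t : is_nat i -> ⟨φ, t⟩ ∈ P ->
    (forall n, n ∈ s <-> n ∈ t /\ n <> i) ->
    inf_step κ P (fAll i φ) s.

(** [φ] is a formula of L_{κ,ω}(∈,Â) with set of free variables [s]: there is
    a set [P] recording a complete analysis of [φ] into subformulas.  The
    analysis is well-founded because a subformula lies in the transitive
    closure of the formula and the axiom of foundation holds. *)
Definition inf_formula κ (φ : sets M) s :=
  exists P, ⟨φ, s⟩ ∈ P /\
    forall ψ t, ⟨ψ, t⟩ ∈ P -> inf_step κ P ψ t.

(** The same for the first-order language L_{ω,ω}(∈,Tr,Â). *)
Inductive fo_step (P : sets M) : sets M -> sets M -> Prop :=
| fo_eq i j : is_nat i -> is_nat j ->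
    fo_step P (fEq i j) (upair i j)
| fo_mem i j : is_nat i -> is_nat j ->
    fo_step P (fMem i j) (upair i j)
| fo_in i : is_nat i ->
    fo_step P (fIn i) (upair i i)
| fo_tr i j l s : is_nat i -> is_nat j -> is_nat l ->
    (forall n, n ∈ s <-> n = i \/ n = j \/ n = l) ->
    fo_step P (fTr i j l) s
| fo_neg φ s : ⟨φ, s⟩ ∈ P ->
    fo_step P (fNeg φ) s
| fo_and φ ψ s t u : ⟨φ, t⟩ ∈ P -> ⟨ψ, u⟩ ∈ P ->
    (forall n, n ∈ s <-> n ∈ t \/ n ∈ u) ->
    fo_step P (fAnd φ ψ) s
| fo_all i φ s t : is_nat i -> ⟨φ, t⟩ ∈ P ->
    (forall n, n ∈ s <-> n ∈ t /\ n <> i) ->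
    fo_step P (fAll i φ) s.

Definition fo_formula (φ : sets M) s :=
  exists P, ⟨φ, s⟩ ∈ P /\
    forall ψ t, ⟨ψ, t⟩ ∈ P -> fo_step P ψ t.

(** * Valuations and truth predicates *)

(** [a] assigns values to finitely many variables, including those in [s]. *)
Definition valuation s a :=
  exists d, finite d /\ (forall n, n ∈ d -> is_nat n) /\
    (forall n, n ∈ s -> n ∈ d) /\ function_on a d.

Definition inf_valuation κ (φ : sets M) a :=
  exists s, inf_formula κ φ s /\ valuation s a.

Definition fo_valuation (φ : sets M) a :=
  exists s, fo_formula φ s /\ valuation s a.

(** [a'] is the valuation [a] with the value at [i] set to [b]. *)
Definition is_update (a' a i b : sets M) :=
  forall p, p ∈ a' <-> p = ⟨i, b⟩ \/ (p ∈ a /\ forall y, p <> ⟨i, y⟩).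

Record truth_predicate κ A T : Prop := {
  tp_dom : forall p, p ∈c T -> exists φ a, inf_valuation κ φ a /\ p = ⟨φ, a⟩;
  tp_eq : forall i j a x y, inf_valuation κ (fEq i j) a ->
    ⟨i, x⟩ ∈ a -> ⟨j, y⟩ ∈ a -> (⟨fEq i j, a⟩ ∈c T <-> x = y);
  tp_mem : forall i j a x y, inf_valuation κ (fMem i j) a ->
    ⟨i, x⟩ ∈ a -> ⟨j, y⟩ ∈ a -> (⟨fMem i j, a⟩ ∈c T <-> x ∈ y);
  tp_in : forall i a x, inf_valuation κ (fIn i) a ->
    ⟨i, x⟩ ∈ a -> (⟨fIn i, a⟩ ∈c T <-> x ∈c A);
  tp_conj : forall Φ a, inf_valuation κ (fConj Φ) a ->
    (⟨fConj Φ, a⟩ ∈c T <-> forall φ, φ ∈ Φ -> ⟨φ, a⟩ ∈c T);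
  tp_neg : forall φ a, inf_valuation κ (fNeg φ) a ->
    (⟨fNeg φ, a⟩ ∈c T <-> ~ ⟨φ, a⟩ ∈c T);
  tp_all : forall i φ a, inf_valuation κ (fAll i φ) a ->
    (⟨fAll i φ, a⟩ ∈c T <->
     forall b a', is_update a' a i b -> ⟨φ, a'⟩ ∈c T)
}.

Local Notation "⟨ x , y , z ⟩" := (opair x (opair y z)) (at level 0).

(** In [itp_tr] the values [x], [y], [z] are arbitrary sets; by [itp_dom] the
    right-hand side fails unless they are an ordinal below [β], a formula and
    a valuation for it. *)
Record iterated_truth_predicate κ A (Tr : classes M) : Prop := {
  itp_dom : forall p, p ∈c Tr ->
    exists β φ a, β ∈ κ /\ fo_valuation φ a /\ p = ⟨β, φ, a⟩;
  itp_eq : forall β i j a x y, β ∈ κ -> fo_valuation (fEq i j) a ->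
    ⟨i, x⟩ ∈ a -> ⟨j, y⟩ ∈ a -> (⟨β, fEq i j, a⟩ ∈c Tr <-> x = y);
  itp_mem : forall β i j a x y, β ∈ κ -> fo_valuation (fMem i j) a ->
    ⟨i, x⟩ ∈ a -> ⟨j, y⟩ ∈ a -> (⟨β, fMem i j, a⟩ ∈c Tr <-> x ∈ y);
  itp_in : forall β i a x, β ∈ κ -> fo_valuation (fIn i) a ->
    ⟨i, x⟩ ∈ a -> (⟨β, fIn i, a⟩ ∈c Tr <-> x ∈c A);
  itp_tr : forall β i j l a x y z, β ∈ κ -> fo_valuation (fTr i j l) a ->
    ⟨i, x⟩ ∈ a -> ⟨j, y⟩ ∈ a -> ⟨l, z⟩ ∈ a ->
    (⟨β, fTr i j l, a⟩ ∈c Tr <-> x ∈ β /\ ⟨x, y, z⟩ ∈c Tr);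
  itp_and : forall β φ ψ a, β ∈ κ -> fo_valuation (fAnd φ ψ) a ->
    (⟨β, fAnd φ ψ, a⟩ ∈c Tr <-> ⟨β, φ, a⟩ ∈c Tr /\ ⟨β, ψ, a⟩ ∈c Tr);
  itp_neg : forall β φ a, β ∈ κ -> fo_valuation (fNeg φ) a ->
    (⟨β, fNeg φ, a⟩ ∈c Tr <-> ~ ⟨β, φ, a⟩ ∈c Tr);
  itp_all : forall β i φ a, β ∈ κ -> fo_valuation (fAll i φ) a ->
    (⟨β, fAll i φ, a⟩ ∈c Tr <->
     forall b a', is_update a' a i b -> ⟨β, φ, a'⟩ ∈c Tr)
}.

End InModel.

(* Main.v *)
From Stdlib Require Import ClassicalEpsilon Arith Lia.
Require Import Defs.

Set Implicit Arguments.
Unset Strict Implicit.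
Unset Printing Implicit Defensive.

(** A claim <c, β, φ, a> asserts that [φ] is true, or false, of [a] at level
    [β].  A first-order formula in one class variable says that a claim is
    justified by claims on smaller pairs (β, φ) that are already settled.  For
    a set [t], let W_t consist of the claims that are justified by, or belong
    to, the union of the W_s with s ∈ t.  As that union is a disjunction over
    [t], membership in W_t is expressed by a formula N_t of L_{κ,ω}(∈,Â),
    defined by ∈-recursion, as long as all members of the transitive closure
    of [t] have fewer than [κ] elements; the truth predicate turns these
    formulas into classes.  A suitable [t] settles uniformly in [a] all claims
    about a given (β, φ) with β ∈ κ: it is built by stacking a copy of ω for
    each α ∈ β, and finitely many steps for [φ], where κ being uncountable is
    what makes ω small.  The settled positive claims are the iterated truth
    predicate. *)

(** * Definability *)

(** Stages only grow, so the absence of a claim from a stage must not count as its negation. Giving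
    falsity claims of its own makes justification monotone: what is settled stays settled, and the
    indices [t] need not be ordinals. That exactly one of the two claims is settled is then proved
    afterwards, by induction on (β, φ).

    The formulas φ belong to the model and may have nonstandard length, so they are not translated
    one by one. Only a single external formula, the justification relation, is translated; its
    syntax is standard, so external numbers suffice to name its variables. The price is that every
    induction on φ or β takes place inside the model and needs a definable induction predicate,
    which is why definability is developed first.

    L_{κ,ω} has conjunctions but no disjunctions, so N_t defines the complement of W_t: the
    complement of a union is the conjunction of the complements. Every N_t has at most x_0 free,
    which meets the restriction to finitely many free variables. *)

Fixpoint rename_sets (σ : nat -> nat) (f : pfml) : pfml :=
  match f with
  | PEq i j => PEq (σ i) (σ j)
  | PMem i j => PMem (σ i) (σ j)
  | PCls i k => PCls (σ i) k
  | PNeg g => PNeg (rename_sets σ g)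
  | PAnd g h => PAnd (rename_sets σ g) (rename_sets σ h)
  | PAll g => PAll (rename_sets (scons 0 (fun n => S (σ n))) g)
  end.

Fixpoint rename_classes (σ : nat -> nat) (f : pfml) : pfml :=
  match f with
  | PEq i j => PEq i j
  | PMem i j => PMem i j
  | PCls i k => PCls i (σ k)
  | PNeg g => PNeg (rename_classes σ g)
  | PAnd g h => PAnd (rename_classes σ g) (rename_classes σ h)
  | PAll g => PAll (rename_classes σ g)
  end.

Lemma psat_ext (M : gb_structure) (f : pfml) (X X' : nat -> classes M)
    (e e' : nat -> sets M) :
  (forall k, X k = X' k) -> (forall n, e n = e' n) ->
  psat X e f <-> psat X' e' f.
Proof.
intros HX; revert e e'; induction f as [i j|i j|i k|g IH|g IHg h IHh|g IH];
  intros e e' He; cbn.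
- now rewrite !He.
- now rewrite !He.
- now rewrite He, HX.
- now rewrite (IH e e').
- now rewrite (IHg e e'), (IHh e e').
- split; intros H x.
  + apply (IH (scons x e)); auto. now intros [|n]; cbn.
  + apply (IH (scons x e) (scons x e')); auto. now intros [|n]; cbn.
Qed.

Lemma psat_rename_sets (M : gb_structure) (f : pfml) (X : nat -> classes M) :
  forall (σ : nat -> nat) (e : nat -> sets M),
  psat X e (rename_sets σ f) <-> psat X (fun n => e (σ n)) f.
Proof.
induction f as [i j|i j|i k|g IH|g IHg h IHh|g IH]; intros σ e; cbn;
  try tauto.
- now rewrite IH.
- now rewrite IHg, IHh.
- assert (E : forall x, psat X (scons x e) (rename_sets (scons 0 (fun n => S (σ n))) g)
      <-> psat X (scons x (fun n => e (σ n))) g).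
  { intros x; rewrite IH; apply psat_ext; auto. now intros [|n]. }
  split; intros H x; now apply E.
Qed.

Lemma psat_rename_classes (M : gb_structure) (f : pfml) (σ : nat -> nat)
    (X : nat -> classes M) : forall e : nat -> sets M,
  psat X e (rename_classes σ f) <-> psat (fun k => X (σ k)) e f.
Proof.
induction f as [i j|i j|i k|g IH|g IHg h IHh|g IH]; intros e; cbn; try tauto.
- now rewrite IH.
- now rewrite IHg, IHh.
- split; intros H x; now apply IH.
Qed.

Section Definability.
Variable M : gbc_model.

(** Definability is relative to a frame: which class parameters may be used,
    and how they depend on an index.  The index makes a single formula serve
    for all values of a class variable. *)
Record frame := Frame {
  index : Type;
  param : Type;
  interp : param -> index -> classes M;
  param0 : param
}.

Section Frame.
Variable F : frame.
Local Notation env := (nat -> sets M).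
Local Notation pred := (index F -> env -> Prop).
Local Notation term := (index F -> env -> sets M).
Local Notation tail e := (fun n => e (S n)).

Definition definable (P : pred) : Prop :=
  exists (f : pfml) (k : nat -> param F),
    forall i e, psat (fun n => interp (k n) i) e f <-> P i e.

Definition dterm (t : term) : Prop :=
  definable (fun i e => e 0 = t i (tail e)).

Lemma definable_iff (P Q : pred) :
  (forall i e, P i e <-> Q i e) -> definable P -> definable Q.
Proof.
intros H [f [k E]]; exists f, k; intros i e; now rewrite E, H.
Qed.

Lemma definable_rename (σ : nat -> nat) (P : pred) :
  definable P -> definable (fun i e => P i (fun n => e (σ n))).
Proof.
intros [f [k E]]; exists (rename_sets σ f), k; intros i e.
now rewrite psat_rename_sets, E.
Qed.

Lemma def_vareq m n : definable (fun i e => e m = e n).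
Proof. exists (PEq m n), (fun _ => param0 F); cbn; tauto. Qed.

Lemma def_varmem m n : definable (fun i e => e m ∈ e n).
Proof. exists (PMem m n), (fun _ => param0 F); cbn; tauto. Qed.

Lemma def_varcls m k : definable (fun i e => e m ∈c interp k i).
Proof. exists (PCls m 0), (fun _ => k); cbn; tauto. Qed.

Lemma def_not (P : pred) : definable P -> definable (fun i e => ~ P i e).
Proof. intros [f [k E]]; exists (PNeg f), k; intros i e; cbn; now rewrite E. Qed.

Lemma def_and (P Q : pred) :
  definable P -> definable Q -> definable (fun i e => P i e /\ Q i e).
Proof.
intros [f [k E]] [g [l E']].
(* The two parameter lists are interleaved: those of [f] at the even class variables, those of [g]
   at the odd ones. *)
exists (PAnd (rename_classes (fun n => 2 * n) f)
             (rename_classes (fun n => S (2 * n)) g)),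
  (fun n => if Nat.even n then k (Nat.div2 n) else l (Nat.div2 n)).
intros i e; cbn [psat]; rewrite !psat_rename_classes, <- E, <- E'.
assert (H1 : forall n, Nat.even (2 * n) = true)
  by (intros n; rewrite Nat.even_mul; reflexivity).
assert (H2 : forall n, Nat.even (S (2 * n)) = false)
  by (intros n; rewrite Nat.even_succ, Nat.odd_mul; reflexivity).
rewrite (@psat_ext M f _ (fun n => interp (k n) i) e e),
  (@psat_ext M g _ (fun n => interp (l n) i) e e); auto; try tauto.
- now intros n; rewrite H2, Nat.div2_succ_double.
- now intros n; rewrite H1, Nat.div2_double.
Qed.

Lemma def_all (P : index F -> sets M -> env -> Prop) :
  definable (fun i e => P i (e 0) (tail e)) ->
  definable (fun i e => forall x, P i x e).
Proof.
intros [f [k E]]; exists (PAll f), k; intros i e; cbn.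
split; intros H x; specialize (H x); now apply (E i (scons x e)).
Qed.

Lemma def_imp (P Q : pred) :
  definable P -> definable Q -> definable (fun i e => P i e -> Q i e).
Proof.
intros HP HQ; apply (@definable_iff (fun i e => ~ (P i e /\ ~ Q i e))).
- intros i e; split; [|tauto]; intros H p; apply NNPP; tauto.
- now apply def_not, def_and; [|apply def_not].
Qed.

Lemma def_or (P Q : pred) :
  definable P -> definable Q -> definable (fun i e => P i e \/ Q i e).
Proof.
intros HP HQ; apply (@definable_iff (fun i e => ~ P i e -> Q i e)).
- intros i e; destruct (classic (P i e)); tauto.
- now apply def_imp; [apply def_not|].
Qed.

Lemma def_iff (P Q : pred) :
  definable P -> definable Q -> definable (fun i e => P i e <-> Q i e).
Proof. intros HP HQ; apply def_and; now apply def_imp. Qed.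

Lemma def_ex (P : index F -> sets M -> env -> Prop) :
  definable (fun i e => P i (e 0) (tail e)) ->
  definable (fun i e => exists x, P i x e).
Proof.
intros HP; apply (@definable_iff (fun i e => ~ forall x, ~ P i x e)).
- intros i e; split.
  + intros H; apply NNPP; firstorder.
  + firstorder.
- now apply def_not, def_all, def_not.
Qed.

Lemma dterm_var n : dterm (fun i e => e n).
Proof. apply def_vareq. Qed.

Lemma dterm_rename (σ : nat -> nat) (t : term) :
  dterm t -> dterm (fun i e => t i (fun n => e (σ n))).
Proof.
intros H; exact (definable_rename (scons 0 (fun n => S (σ n))) H).
Qed.

(** Formulas have no terms; a term is eliminated by quantifying over its value. Repeated use gives
    the [def_pred] lemmas, which carry a definition in variables over to arbitrary terms. *)
Lemma def_subst (t : term) (P : index F -> sets M -> env -> Prop) :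
  dterm t -> definable (fun i e => P i (e 0) (tail e)) ->
  definable (fun i e => P i (t i e) e).
Proof.
intros Ht HP.
apply (@definable_iff (fun i e => exists x, x = t i e /\ P i x e)).
- intros i e; split; [|eauto]. now intros [x [-> Hx]].
- now apply def_ex, def_and.
Qed.

Lemma def_pred1 (P : sets M -> Prop) (t : term) :
  definable (fun _ e => P (e 0)) -> dterm t ->
  definable (fun i e => P (t i e)).
Proof.
intros HP Ht; apply (@def_subst t (fun i x e => P x)); auto.
Qed.

Lemma def_pred2 (P : sets M -> sets M -> Prop) (t u : term) :
  definable (fun _ e => P (e 0) (e 1)) -> dterm t -> dterm u ->
  definable (fun i e => P (t i e) (u i e)).
Proof.
intros HP Ht Hu; apply (@def_subst t (fun i x e => P x (u i e))); auto.
apply (@def_subst (fun i e => u i (tail e)) (fun i y e => P (e 0) y)).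
- now apply (@dterm_rename S).
- exact (definable_rename (fun n => match n with 0 => 1 | _ => 0 end) HP).
Qed.

Lemma def_pred3 (P : sets M -> sets M -> sets M -> Prop) (t u v : term) :
  definable (fun _ e => P (e 0) (e 1) (e 2)) -> dterm t -> dterm u -> dterm v ->
  definable (fun i e => P (t i e) (u i e) (v i e)).
Proof.
intros HP Ht Hu Hv; apply (@def_subst t (fun i x e => P x (u i e) (v i e))); auto.
apply (@def_subst (fun i e => u i (tail e)) (fun i y e => P (e 0) y (v i (tail e)))).
- now apply (@dterm_rename S).
- apply (@def_subst (fun i e => v i (fun n => e (S (S n))))
    (fun i y e => P (e 1) (e 0) y)).
  + now apply (@dterm_rename (fun n => S (S n))).
  (* Each substitution puts its value at index 0 and shifts the earlier ones, so the arguments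
     arrive in reverse order. *)
  + exact (definable_rename
      (fun n => match n with 0 => 2 | 1 => 1 | _ => 0 end) HP).
Qed.

Lemma def_pred4 (P : sets M -> sets M -> sets M -> sets M -> Prop)
    (t u v w : term) :
  definable (fun _ e => P (e 0) (e 1) (e 2) (e 3)) ->
  dterm t -> dterm u -> dterm v -> dterm w ->
  definable (fun i e => P (t i e) (u i e) (v i e) (w i e)).
Proof.
intros HP Ht Hu Hv Hw.
apply (@def_subst t (fun i x e => P x (u i e) (v i e) (w i e))); auto.
apply (@def_subst (fun i e => u i (tail e))
  (fun i y e => P (e 0) y (v i (tail e)) (w i (tail e)))).
- now apply (@dterm_rename S).
- apply (@def_subst (fun i e => v i (fun n => e (S (S n))))
    (fun i y e => P (e 1) (e 0) y (w i (fun n => e (S (S n)))))).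
  + now apply (@dterm_rename (fun n => S (S n))).
  + apply (@def_subst (fun i e => w i (fun n => e (S (S (S n)))))
      (fun i y e => P (e 2) (e 1) (e 0) y)).
    * now apply (@dterm_rename (fun n => S (S (S n)))).
    * exact (definable_rename
        (fun n => match n with 0 => 3 | 1 => 2 | 2 => 1 | _ => 0 end) HP).
Qed.

Lemma def_eq (t u : term) :
  dterm t -> dterm u -> definable (fun i e => t i e = u i e).
Proof. apply (@def_pred2 (fun x y => x = y)), def_vareq. Qed.

Lemma def_mem (t u : term) :
  dterm t -> dterm u -> definable (fun i e => t i e ∈ u i e).
Proof. apply (@def_pred2 (fun x y => x ∈ y)), def_varmem. Qed.

Lemma def_cls (k : param F) (t : term) :
  dterm t -> definable (fun i e => t i e ∈c interp k i).
Proof. intros Ht; apply (@def_subst t (fun i x e => x ∈c interp k i)); auto.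
apply def_varcls. Qed.

Lemma dterm_fun1 (g : sets M -> sets M) (t : term) :
  dterm (fun _ e => g (e 0)) -> dterm t -> dterm (fun i e => g (t i e)).
Proof.
intros Hg Ht; unfold dterm.
apply (@def_pred2 (fun y x => y = g x)); [exact Hg|apply dterm_var|].
now apply (@dterm_rename S).
Qed.

Lemma dterm_fun2 (g : sets M -> sets M -> sets M) (t u : term) :
  dterm (fun _ e => g (e 0) (e 1)) -> dterm t -> dterm u ->
  dterm (fun i e => g (t i e) (u i e)).
Proof.
intros Hg Ht Hu; unfold dterm.
apply (@def_pred3 (fun y x z => y = g x z)); [exact Hg|apply dterm_var| |];
  now apply (@dterm_rename S).
Qed.

End Frame.

(** [param0] has to be some class. Comprehension itself asks for an assignment of the class
    variables, so a first class is taken from global choice. *)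
Definition full_frame : frame :=
  @Frame unit (classes M) (fun X _ => X)
    (proj1_sig (constructive_indefinite_description _
      (gbc_global_choice (gbc_axioms M)))).

Lemma comprehension (P : sets M -> Prop) :
  definable (F := full_frame) (fun _ e => P (e 0)) ->
  exists Y : classes M, forall x, x ∈c Y <-> P x.
Proof.
intros [f [k E]].
destruct (gbc_comprehension (gbc_axioms M) f k (fun _ => empty M)) as [Y HY].
exists Y; intros x; rewrite HY; apply (E tt).
Qed.

(** Only classes serve as parameters, so the set [c] enters through the class with the same members,
    and extensionality recovers [c] from it. *)
Lemma dterm_const (c : sets M) : dterm (F := full_frame) (fun _ _ => c).
Proof.
destruct (gbc_comprehension (gbc_axioms M) (PMem 0 1)
  (fun _ => param0 full_frame) (fun _ => c)) as [Y HY]; cbn in HY.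
apply (@definable_iff full_frame (fun _ e => forall z, z ∈ e 0 <-> z ∈c Y)).
- intros _ e; split.
  + intros H; apply (gbc_set_ext (gbc_axioms M)); intros z; now rewrite H, HY.
  + intros -> z; now rewrite HY.
- apply (@def_all full_frame (fun _ z e => z ∈ e 0 <-> z ∈c Y)), def_iff.
  + apply def_varmem.
  + apply (def_varcls (F := full_frame) 0 Y).
Qed.

Lemma def_cmem (Y : classes M) t :
  dterm (F := full_frame) t -> definable (F := full_frame) (fun i e => t i e ∈c Y).
Proof. exact (@def_cls full_frame Y t). Qed.

End Definability.

Create HintDb dfn.
#[export] Hint Resolve def_not def_and def_or def_imp def_iff def_all def_ex
  def_eq def_mem dterm_var dterm_const def_cmem : dfn.

Ltac dfn := auto 200 with dfn nocore.

(** * Set theory in the model *)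

Section SetTheory.
Variable M : gbc_model.
Local Notation V := (sets M).
Local Notation full := (full_frame M).
Local Notation "⟨ x , y ⟩" := (opair x y) (at level 0).

Lemma set_ext (x y : V) : (forall z, z ∈ x <-> z ∈ y) -> x = y.
Proof. apply (gbc_set_ext (gbc_axioms M)). Qed.

(** By extensionality, a definition of the members of a set also defines the set. This and the next
    two lemmas make the set operations below available as terms. *)
Lemma dterm_ext0 F (c : V) (P : V -> Prop) :
  (forall w, w ∈ c <-> P w) -> definable (F := F) (fun _ e => P (e 0)) ->
  dterm (F := F) (fun _ _ => c).
Proof.
intros Hc HP; apply (@definable_iff M F (fun _ e => forall w, w ∈ e 0 <-> P w)).
- intros _ e; split; [|intros ->; apply Hc].
  intros H; apply set_ext; intros z; now rewrite H, Hc.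
- assert (HP' := fun t => @def_pred1 M F P t HP). dfn.
Qed.

Lemma dterm_ext1 F (g : V -> V) (P : V -> V -> Prop) t :
  (forall x w, w ∈ g x <-> P w x) ->
  definable (F := F) (fun _ e => P (e 0) (e 1)) ->
  dterm (F := F) t -> dterm (F := F) (fun i e => g (t i e)).
Proof.
intros Hg HP; apply (@dterm_fun1 M F g).
apply (@definable_iff M F (fun _ e => forall w, w ∈ e 0 <-> P w (e 1))).
- intros _ e; split; [|intros ->; apply Hg].
  intros H; apply set_ext; intros z; now rewrite H, Hg.
- assert (HP' := fun t u => @def_pred2 M F P t u HP). dfn.
Qed.

Lemma dterm_ext2 F (g : V -> V -> V) (P : V -> V -> V -> Prop) t u :
  (forall x y w, w ∈ g x y <-> P w x y) ->
  definable (F := F) (fun _ e => P (e 0) (e 1) (e 2)) ->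
  dterm (F := F) t -> dterm (F := F) u ->
  dterm (F := F) (fun i e => g (t i e) (u i e)).
Proof.
intros Hg HP; apply (@dterm_fun2 M F g).
apply (@definable_iff M F (fun _ e => forall w, w ∈ e 0 <-> P w (e 1) (e 2))).
- intros _ e; split; [|intros ->; apply Hg].
  intros H; apply set_ext; intros z; now rewrite H, Hg.
- assert (HP' := fun t u v => @def_pred3 M F P t u v HP). dfn.
Qed.

Lemma def_false F : definable (M := M) (F := F) (fun _ _ => False).
Proof.
apply (@definable_iff M F (fun _ e => e 0 <> e 0)); [tauto|dfn].
Qed.
Hint Resolve def_false : dfn.

Lemma dterm_empty F : dterm (F := F) (fun _ _ => empty M).
Proof.
apply (@dterm_ext0 F _ (fun _ => False)); [|dfn].
intros w; split; [apply emptyP|tauto].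
Qed.

Lemma dterm_upair F t u : dterm t -> dterm u ->
  dterm (M := M) (F := F) (fun i e => upair (t i e) (u i e)).
Proof.
apply (@dterm_ext2 F (fun x y => upair x y) (fun w x y => w = x \/ w = y)).
- intros; apply upairP.
- dfn.
Qed.
Hint Resolve dterm_empty dterm_upair : dfn.

Lemma dterm_opair F t u : dterm t -> dterm u ->
  dterm (M := M) (F := F) (fun i e => opair (t i e) (u i e)).
Proof. unfold opair; dfn. Qed.
Hint Resolve dterm_opair : dfn.

Lemma dterm_tag F k : dterm (F := F) (fun _ _ => tag M k).
Proof. induction k; cbn; dfn. Qed.
Hint Resolve dterm_tag : dfn.

Lemma in_upair (w x y : V) : w ∈ upair x y <-> w = x \/ w = y.
Proof. apply upairP. Qed.

Lemma upair_inj (x y z : V) : upair x y = upair x z -> y = z.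
Proof.
intros H.
assert (Hy : y ∈ upair x z) by (rewrite <- H; apply in_upair; auto).
assert (Hz : z ∈ upair x y) by (rewrite H; apply in_upair; auto).
apply in_upair in Hy; apply in_upair in Hz.
destruct Hy as [Hy|Hy]; destruct Hz; congruence.
Qed.

Lemma upair_diag (x y z : V) : upair x x = upair y z -> x = y /\ x = z.
Proof.
intros H; split; symmetry.
- assert (Hy : y ∈ upair x x) by (rewrite H; apply in_upair; auto).
  apply in_upair in Hy; tauto.
- assert (Hz : z ∈ upair x x) by (rewrite H; apply in_upair; auto).
  apply in_upair in Hz; tauto.
Qed.

Lemma opair_inj (x y x' y' : V) : ⟨x, y⟩ = ⟨x', y'⟩ -> x = x' /\ y = y'.
Proof.
unfold opair; intros H.
assert (E : x = x').
{ assert (Hx : upair x x ∈ upair (upair x' x') (upair x' y'))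
    by (rewrite <- H; apply in_upair; auto).
  apply in_upair in Hx; destruct Hx as [Hx|Hx]; apply upair_diag in Hx; tauto. }
subst x'; split; auto. now apply upair_inj in H; apply upair_inj in H.
Qed.

Lemma is_opair_iff (p x y : V) : is_opair p x y <-> p = ⟨x, y⟩.
Proof.
split; [|intros ->; apply opairP].
intros [u [v [Hu [Hv Hp]]]].
assert (Eu : u = upair x x)
  by (apply set_ext; intros z; now rewrite (Hu z), in_upair).
assert (Ev : v = upair x y)
  by (apply set_ext; intros z; now rewrite (Hv z), in_upair).
subst; apply set_ext; intros z; unfold opair; now rewrite (Hp z), in_upair.
Qed.

Lemma tag_inj k m : tag M k = tag M m -> k = m.
Proof.
revert m; induction k as [|k IH]; intros [|m]; cbn; auto.
- intros H; exfalso; apply (@emptyP M (tag M m)); rewrite H; apply in_upair; auto.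
- intros H; exfalso; apply (@emptyP M (tag M k)); rewrite <- H; apply in_upair; auto.
- intros H; apply upair_diag in H; f_equal; now apply IH.
Qed.

(** Foundation is applied to the class of counterexamples, which exists only for definable [P]. *)
Lemma mem_ind (P : V -> Prop) :
  definable (F := full) (fun _ e => P (e 0)) ->
  (forall x, (forall y, y ∈ x -> P y) -> P x) -> forall x, P x.
Proof.
intros HP IH x; apply NNPP; intros Hx.
destruct (@comprehension M (fun x => ~ P x)) as [Y HY]; [dfn|].
destruct (gbc_foundation (gbc_axioms M) (X := Y)) as [z [Hz Hmin]].
- exists x; now apply HY.
- apply HY in Hz; apply Hz, IH; intros y Hy.
  specialize (Hmin y Hy); apply NNPP; intros H; now apply Hmin, HY.
Qed.

Lemma replacement (R : V -> V -> Prop) (a : V) :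
  definable (F := full) (fun _ e => R (e 0) (e 1)) ->
  (forall x y y', R x y -> R x y' -> y = y') ->
  exists b, forall y, y ∈ b <-> exists x, x ∈ a /\ R x y.
Proof.
intros HR Hfun.
assert (HR' := fun t u => @def_pred2 M full R t u HR).
destruct (@comprehension M (fun p => exists x y, p = ⟨x, y⟩ /\ R x y))
  as [Y HY]; [dfn|].
destruct (gbc_replacement (gbc_axioms M) (F := Y) a) as [b Hb].
- intros x y y' p p' Hp Hp' H H'.
  apply is_opair_iff in Hp; apply is_opair_iff in Hp'; subst.
  apply HY in H; apply HY in H'.
  destruct H as [u [v [E H]]]; destruct H' as [u' [v' [E' H']]].
  apply opair_inj in E; apply opair_inj in E'; destruct E, E'; subst; eauto.
- exists b; intros y; rewrite Hb; split.
  + intros [x [p [Hx [Hp H]]]]; exists x; split; auto.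
    apply is_opair_iff in Hp; subst; apply HY in H.
    destruct H as [u [v [E H]]]; apply opair_inj in E; destruct E; now subst.
  + intros [x [Hx H]]; exists x, ⟨x, y⟩; repeat split; auto.
    * apply opairP.
    * apply HY; eauto.
Qed.

Lemma separation (P : V -> Prop) (a : V) :
  definable (F := full) (fun _ e => P (e 0)) ->
  exists b, forall x, x ∈ b <-> x ∈ a /\ P x.
Proof.
intros HP; assert (HP' := fun t => @def_pred1 M full P t HP).
destruct (@replacement (fun x y => x = y /\ P x) a) as [b Hb]; [dfn|intuition congruence|].
exists b; intros x; rewrite Hb; split.
- now intros [y [Hy [-> H]]].
- intros [Hx H]; eauto.
Qed.

(** The set [{y | P y}], arbitrary when there is no such set. *)
Definition setof (P : V -> Prop) : V :=
  epsilon (inhabits (empty M)) (fun b => forall y, y ∈ b <-> P y).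

Lemma in_setof (P : V -> Prop) (y : V) :
  (exists b, forall y, y ∈ b <-> P y) -> y ∈ setof P <-> P y.
Proof. intros H; apply (epsilon_spec (inhabits (empty M)) _ H). Qed.

Definition union (x : V) : V := setof (fun w => exists y, y ∈ x /\ w ∈ y).

Lemma in_union (w x : V) : w ∈ union x <-> exists y, y ∈ x /\ w ∈ y.
Proof. apply in_setof, (gbc_union (gbc_axioms M)). Qed.

Lemma dterm_union F t : dterm t -> dterm (M := M) (F := F) (fun i e => union (t i e)).
Proof.
apply (dterm_ext1 (g := union) (P := fun w x => exists y, y ∈ x /\ w ∈ y)); [|dfn].
intros; apply in_union.
Qed.

Definition cup (x y : V) : V := union (upair x y).

Lemma in_cup (w x y : V) : w ∈ cup x y <-> w ∈ x \/ w ∈ y.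
Proof.
unfold cup; rewrite in_union; split.
- intros [z [Hz Hw]]; apply in_upair in Hz; destruct Hz; subst; auto.
- intros [H|H]; [exists x|exists y]; rewrite in_upair; auto.
Qed.

Lemma dterm_cup F t u : dterm t -> dterm u ->
  dterm (M := M) (F := F) (fun i e => cup (t i e) (u i e)).
Proof. unfold cup; intros; apply dterm_union; dfn. Qed.

Definition image (f : V -> V) (a : V) : V :=
  setof (fun y => exists x, x ∈ a /\ y = f x).

Lemma in_image (f : V -> V) (a y : V) :
  dterm (F := full) (fun _ e => f (e 0)) ->
  y ∈ image f a <-> exists x, x ∈ a /\ y = f x.
Proof.
intros Hf; apply in_setof.
assert (Hf' := fun t => @dterm_fun1 M full f t Hf).
apply (@replacement (fun x y => y = f x)); [dfn|congruence].
Qed.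

Lemma dterm_image (f : V -> V -> V) t u :
  dterm (F := full) (fun _ e => f (e 0) (e 1)) ->
  dterm t -> dterm u ->
  dterm (F := full) (fun i e => image (f (t i e)) (u i e)).
Proof.
intros Hf; assert (Hf' := fun t u => @dterm_fun2 M full f t u Hf).
apply (dterm_ext2 (g := fun q a => image (f q) a)
  (P := fun w q a => exists x, x ∈ a /\ w = f q x)); [|dfn].
intros; apply in_image; dfn.
Qed.

(** * Transitive closures and the well-founded order they induce *)

Definition transitive (x : V) := forall y z, y ∈ x -> z ∈ y -> z ∈ x.

Definition is_tc (x u : V) :=
  x ∈ u /\ transitive u /\
  forall v, x ∈ v -> transitive v -> forall y, y ∈ u -> y ∈ v.

Lemma def_transitive F t : dterm t ->
  definable (M := M) (F := F) (fun i e => transitive (t i e)).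
Proof. apply (def_pred1 (P := transitive)); unfold transitive; dfn. Qed.
Hint Resolve def_transitive : dfn.

Lemma def_is_tc F t u : dterm t -> dterm u ->
  definable (M := M) (F := F) (fun i e => is_tc (t i e) (u i e)).
Proof. apply (def_pred2 (P := is_tc)); unfold is_tc; dfn. Qed.
Hint Resolve def_is_tc : dfn.

Lemma is_tc_unique (x u v : V) : is_tc x u -> is_tc x v -> u = v.
Proof.
intros [H1 [H2 H3]] [K1 [K2 K3]]; apply set_ext; intros z; split; auto.
Qed.

(** By ∈-induction: the closure of [x] consists of [x] and the union of the closures of its members,
    collected by replacement. *)
Lemma is_tc_exists : forall x : V, exists u, is_tc x u.
Proof.
apply mem_ind; [dfn|]; intros x IH.
destruct (@replacement is_tc x) as [b Hb]; [dfn|apply is_tc_unique|].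
exists (cup (upair x x) (union b)).
assert (Hin : forall w, w ∈ cup (upair x x) (union b) <->
  w = x \/ exists z u, z ∈ x /\ is_tc z u /\ w ∈ u).
{ intros w; rewrite in_cup, in_upair, in_union; split.
  - intros [H|[u [Hu Hw]]]; [tauto|].
    apply Hb in Hu; destruct Hu as [z [Hz Hu]]; right; eauto.
  - intros [H|[z [u [Hz [Hu Hw]]]]]; [tauto|].
    right; exists u; split; auto; apply Hb; eauto. }
split; [|split].
- apply Hin; auto.
- intros y z Hy Hz; apply Hin in Hy; apply Hin; right.
  destruct Hy as [->|[w [u [Hw [Hu Hy]]]]].
  + destruct (IH z Hz) as [u Hu]; exists z, u; split; [|split]; auto; exact (proj1 Hu).
  + exists w, u; split; [|split]; auto; now apply (proj1 (proj2 Hu)) with y.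
- intros v Hv Hvt y Hy; apply Hin in Hy.
  destruct Hy as [->|[w [u [Hw [Hu Hy]]]]]; auto.
  apply (proj2 (proj2 Hu)); auto. now apply Hvt with x.
Qed.

Definition tc (x : V) : V := epsilon (inhabits (empty M)) (is_tc x).

Lemma tcP (x : V) : is_tc x (tc x).
Proof. exact (epsilon_spec _ _ (is_tc_exists x)). Qed.

Lemma tc_refl (x : V) : x ∈ tc x.
Proof. apply tcP. Qed.

Lemma tc_transitive (x y z : V) : y ∈ tc x -> z ∈ y -> z ∈ tc x.
Proof. apply tcP. Qed.

Lemma tc_trans (x y z : V) : z ∈ tc y -> y ∈ tc x -> z ∈ tc x.
Proof. intros Hz Hy; apply (tcP y); auto; apply tcP. Qed.

Lemma tc_step (x y z : V) : z ∈ x -> y ∈ tc z -> y ∈ tc x.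
Proof.
intros Hz Hy; apply tc_trans with z; auto.
apply tc_transitive with x; auto; apply tc_refl.
Qed.

Lemma dterm_tc F t : dterm t -> dterm (M := M) (F := F) (fun i e => tc (t i e)).
Proof.
apply (dterm_fun1 (g := tc)).
apply (@definable_iff M F (fun i e => is_tc (e 1) (e 0))); [|dfn].
intros _ e; split.
- intros H; apply (is_tc_unique H), tcP.
- intros ->; apply tcP.
Qed.
Hint Resolve dterm_tc : dfn.

(** The transitive closure of the relation ∈, as a strict order. *)
Definition below (y x : V) := exists z, z ∈ x /\ y ∈ tc z.

Lemma def_below F t u : dterm t -> dterm u ->
  definable (M := M) (F := F) (fun i e => below (t i e) (u i e)).
Proof. apply (def_pred2 (P := below)); unfold below; dfn. Qed.
Hint Resolve def_below : dfn.

(** From left to right, minimality of [tc x] is applied to its subset of those [y] satisfying the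
    right-hand side; this is a transitive set containing [x]. *)
Lemma tc_cases (x y : V) : y ∈ tc x <-> y = x \/ below y x.
Proof.
split.
- revert y.
  destruct (@separation (fun y => y = x \/ below y x) (tc x)) as [b Hb]; [dfn|].
  intros y Hy; apply Hb.
  apply (tcP x); auto.
  + apply Hb; split; auto; apply tc_refl.
  + intros u z Hu Hz; apply Hb in Hu; apply Hb; destruct Hu as [Hu1 Hu2]; split.
    * now apply tc_transitive with u.
    * right; destruct Hu2 as [->|[w [Hw Hu]]].
      -- exists z; split; auto; apply tc_refl.
      -- exists w; split; auto; now apply tc_transitive with u.
- intros [->|[z [Hz Hy]]]; [apply tc_refl|now apply tc_step with z].
Qed.

Lemma below_mem (x y : V) : y ∈ x -> below y x.
Proof. intros H; exists y; split; auto; apply tc_refl. Qed.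

Lemma below_trans (x y z : V) : below z y -> below y x -> below z x.
Proof.
intros Hz [w [Hw Hy]]; exists w; split; auto.
apply tc_trans with y; auto. apply tc_cases; auto.
Qed.

(** If [x] lies in the closure of its member [z], then [z ∈ x] puts [z] below itself, against the
    induction hypothesis. *)
Lemma below_irrefl : forall x : V, ~ below x x.
Proof.
apply mem_ind; [dfn|]; intros x IH [z [Hz Hx]].
apply (IH z Hz); apply below_trans with x; [now apply below_mem|].
apply tc_cases in Hx; destruct Hx as [->|Hx]; auto.
now apply below_mem.
Qed.

Lemma mem_irrefl (x : V) : ~ x ∈ x.
Proof. intros H; apply (@below_irrefl x), below_mem, H. Qed.

Lemma below_ind (P : V -> Prop) :
  definable (F := full) (fun _ e => P (e 0)) ->
  (forall x, (forall y, below y x -> P y) -> P x) -> forall x, P x.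
Proof.
intros HP IH x; assert (HP' := fun t => @def_pred1 M full P t HP).
cut (forall x y, y ∈ tc x -> P y).
{ intros H; apply (H x), tc_refl. }
clear x; apply (@mem_ind (fun x => forall y, y ∈ tc x -> P y)); [dfn|].
intros x IHx.
assert (K : forall y, below y x -> P y) by (intros y [z [Hz Hy]]; eauto).
intros y Hy; apply tc_cases in Hy; destruct Hy as [->|]; auto.
Qed.

Definition below_set (x : V) : V := union (image tc x).

Lemma in_below_set (x y : V) : y ∈ below_set x <-> below y x.
Proof.
unfold below_set; rewrite in_union; split.
- intros [u [Hu Hy]]; apply in_image in Hu; [|dfn].
  destruct Hu as [z [Hz ->]]; now exists z.
- intros [z [Hz Hy]]; exists (tc z); split; auto.
  apply in_image; [dfn|eauto].
Qed.

Lemma below_upair_l (x y : V) : below x (upair x y).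
Proof. apply below_mem, in_upair; auto. Qed.

Lemma below_upair_r (x y : V) : below y (upair x y).
Proof. apply below_mem, in_upair; auto. Qed.

Lemma below_opair_l (x y : V) : below x ⟨x, y⟩.
Proof.
apply below_trans with (upair x x); [apply below_upair_l|apply below_upair_l].
Qed.

Lemma below_opair_r (x y : V) : below y ⟨x, y⟩.
Proof.
apply below_trans with (upair x y); [apply below_upair_r|apply below_upair_r].
Qed.

(** * Recursion on membership *)

Section Recursion.
Variable g : V -> V -> V.
Hypothesis g_def : dterm (F := full) (fun _ e => g (e 0) (e 1)).

Let dterm_g := fun t u => @dterm_fun2 M full g t u g_def.

(** [f] need not be a function: values are unique by ∈-induction, so that
    approximations never have to be glued. *)
Definition computation (q f : V) :=
  forall u v, ⟨u, v⟩ ∈ f ->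
    (forall z, z ∈ u -> exists w, ⟨z, w⟩ ∈ f) /\
    exists Z, (forall w, w ∈ Z <-> exists z, z ∈ u /\ ⟨z, w⟩ ∈ f) /\ v = g q Z.

Definition computes (q x y : V) := exists f, computation q f /\ ⟨x, y⟩ ∈ f.

Lemma def_computes t u v : dterm t -> dterm u -> dterm v ->
  definable (F := full) (fun i e => computes (t i e) (u i e) (v i e)).
Proof.
apply (def_pred3 (P := computes)); unfold computes, computation; dfn.
Qed.

Lemma computes_unique (q : V) : forall x y y',
  computes q x y -> computes q x y' -> y = y'.
Proof.
pose proof def_computes.
apply (@mem_ind (fun x => forall y y', computes q x y -> computes q x y' -> y = y'));
  [dfn|].
intros x IH y y' [f [Hf Hy]] [f' [Hf' Hy']].
destruct (Hf _ _ Hy) as [K [Z [HZ ->]]], (Hf' _ _ Hy') as [K' [Z' [HZ' ->]]].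
f_equal; apply set_ext; intros w; rewrite HZ, HZ'; split; intros [z [Hz Hw]];
  exists z; split; auto.
- destruct (K' z Hz) as [w' Hw'].
  rewrite (IH z Hz w w'); auto; solve [now exists f | now exists f'].
- destruct (K z Hz) as [w' Hw'].
  rewrite (IH z Hz w w'); auto; solve [now exists f | now exists f'].
Qed.

(** Since values are unique, replacement collects all computed pairs with first component below [x]
    into one set; adjoining the pair of [x] and [g q Z] gives a computation for [x]. *)
Lemma computes_step (q x y : V) (Z : V) :
  (forall z, z ∈ x -> exists w, computes q z w) ->
  (forall w, w ∈ Z <-> exists z, z ∈ x /\ computes q z w) ->
  y = g q Z -> computes q x y.
Proof.
intros IH HZ ->; pose proof def_computes.
destruct (@replacement (fun u p => exists v, computes q u v /\ p = ⟨u, v⟩)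
  (below_set x)) as [f0 Hf0]; [dfn| |].
{ intros u p p' [v [Hv ->]] [v' [Hv' ->]]; f_equal; now apply computes_unique with q u. }
set (f := cup f0 (upair ⟨x, g q Z⟩ ⟨x, g q Z⟩)).
assert (Hf : forall u v, ⟨u, v⟩ ∈ f <->
  below u x /\ computes q u v \/ u = x /\ v = g q Z).
{ intros u v; unfold f; rewrite in_cup, in_upair, Hf0; split.
  - intros [[z [Hz [w [Hw E]]]]|[E|E]]; apply opair_inj in E; destruct E; subst; auto.
    rewrite in_below_set in Hz; auto.
  - intros [[H1 H2]|[-> ->]]; auto. left; exists u; rewrite in_below_set; eauto. }
assert (Hf' : forall u v, below u x -> ⟨u, v⟩ ∈ f <-> computes q u v).
{ intros u v Hu; rewrite Hf; split; [|tauto].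
  intros [[_ K]|[-> _]]; auto; exfalso; now apply (@below_irrefl x). }
exists f; split; [|apply Hf; auto].
intros u v Huv; apply Hf in Huv; destruct Huv as [[Hu Huv]|[-> ->]].
- destruct Huv as [fu [Hfu Huv]]; destruct (Hfu u v Huv) as [K [Z' [HZ' ->]]].
  assert (Hb : forall z, z ∈ u -> below z x).
  { intros z Hz; apply below_trans with u; auto; now apply below_mem. }
  split.
  + intros z Hz; destruct (K z Hz) as [w Hw]; exists w; apply Hf'; auto.
    now exists fu.
  + exists Z'; split; auto; intros w; rewrite HZ'; split; intros [z [Hz Hw]];
      exists z; split; auto.
    * apply Hf'; auto; now exists fu.
    * apply Hf' in Hw; auto; destruct (K z Hz) as [w' Hw'].
      rewrite (@computes_unique q z w w'); auto; now exists fu.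
- split.
  + intros z Hz; destruct (IH z Hz) as [w Hw]; exists w; apply Hf'; auto.
    now apply below_mem.
  + exists Z; split; auto; intros w; rewrite HZ; split; intros [z [Hz Hw]];
      exists z; split; auto; apply (Hf' z w) in Hw || apply Hf'; auto;
      now apply below_mem.
Qed.

Lemma computes_exists (q : V) : forall x, exists y, computes q x y.
Proof.
pose proof def_computes.
apply mem_ind; [dfn|]; intros x IH.
destruct (@replacement (computes q) x) as [Z HZ]; [dfn|apply computes_unique|].
exists (g q Z); now apply computes_step with Z.
Qed.

(** The step function sees only the set of values at the members. The parameter [q] lets towers be
    built over a varying base. *)
Lemma recursion : exists f : V -> V -> V,
  dterm (F := full) (fun _ e => f (e 0) (e 1)) /\
  forall q x, f q x = g q (image (f q) x).
Proof.
pose proof def_computes.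
assert (Hf : exists f, forall q x, computes q x (f q x)).
{ exists (fun q x => epsilon (inhabits (empty M)) (computes q x)).
  intros q x; exact (epsilon_spec _ _ (computes_exists q x)). }
destruct Hf as [f Hf].
assert (D : dterm (F := full) (fun _ e => f (e 0) (e 1))).
{ apply (@definable_iff M full (fun _ e => computes (e 1) (e 2) (e 0))); [|dfn].
  intros _ e; split.
  - intros K; now apply computes_unique with (e 1) (e 2).
  - intros ->; auto. }
exists f; split; auto.
intros q x; apply computes_unique with q x; auto.
eapply computes_step; [intros; now apply computes_exists| |reflexivity].
intros w; rewrite in_image.
- split; intros [z [Hz Hw]]; exists z; split; auto.
  + now subst.
  + now apply computes_unique with q z.
- exact (@dterm_fun2 M full f _ _ D (dterm_const _) (dterm_var _ _)).
Qed.

End Recursion.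
End SetTheory.

#[export] Hint Resolve def_false dterm_empty dterm_upair dterm_opair dterm_tag
  dterm_union dterm_cup def_transitive def_is_tc dterm_tc def_below : dfn.

(** * Natural numbers and finite sets *)

Section Sizes.
Variable M : gbc_model.
Local Notation V := (sets M).
Local Notation full := (full_frame M).
Local Notation "⟨ x , y ⟩" := (opair x y) (at level 0).

Definition suc (x : V) : V := cup x (upair x x).

Lemma in_suc (w x : V) : w ∈ suc x <-> w ∈ x \/ w = x.
Proof. unfold suc; rewrite in_cup, in_upair; tauto. Qed.

Lemma is_succ_iff (y x : V) : is_succ y x <-> y = suc x.
Proof.
split; [|intros ->; intros w; apply in_suc].
intros H; apply set_ext; intros z; now rewrite (H z), in_suc.
Qed.

Lemma dterm_suc F t : dterm t -> dterm (M := M) (F := F) (fun i e => suc (t i e)).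
Proof. unfold suc; dfn. Qed.
Hint Resolve dterm_suc : dfn.

Lemma is_empty_iff (x : V) : is_empty x <-> x = empty M.
Proof.
split; [|intros ->; apply emptyP].
intros H; apply set_ext; intros z; split; intros K; exfalso;
  [now apply (H z)|now apply (@emptyP M z)].
Qed.

Lemma inductive_set_iff (I : V) :
  inductive_set I <-> empty M ∈ I /\ forall x, x ∈ I -> suc x ∈ I.
Proof.
split.
- intros [[e [He Ie]] H]; apply is_empty_iff in He; subst e; split; auto.
  intros x Hx; destruct (H x Hx) as [y [Hy Iy]]; apply is_succ_iff in Hy; now subst.
- intros [H0 H]; split; [exists (empty M); split; auto; apply emptyP|].
  intros x Hx; exists (suc x); split; [now apply is_succ_iff|auto].
Qed.

Lemma def_is_nat F t : dterm t ->
  definable (M := M) (F := F) (fun i e => is_nat (t i e)).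
Proof.
apply (def_pred1 (P := fun x => is_nat x)); unfold is_nat.
apply (@definable_iff M F (fun _ e => forall I,
  empty M ∈ I /\ (forall x, x ∈ I -> suc x ∈ I) -> e 0 ∈ I)); [|dfn].
intros _ e; split; intros H I; specialize (H I); rewrite inductive_set_iff in *; auto.
Qed.
Hint Resolve def_is_nat : dfn.

Lemma nat_empty : is_nat (empty M).
Proof. intros I HI; apply inductive_set_iff in HI; apply HI. Qed.

Lemma nat_suc (n : V) : is_nat n -> is_nat (suc n).
Proof.
intros H I HI; specialize (H I HI); apply inductive_set_iff in HI; now apply HI.
Qed.

Fixpoint num (k : nat) : V := match k with 0 => empty M | S k => suc (num k) end.

Lemma dterm_num F k : dterm (M := M) (F := F) (fun _ _ => num k).
Proof. induction k; cbn; dfn. Qed.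

Lemma nat_num k : is_nat (num k).
Proof. induction k; cbn; [apply nat_empty|now apply nat_suc]. Qed.

Lemma in_num k (x : V) : x ∈ num k <-> exists i, i < k /\ x = num i.
Proof.
induction k as [|k IH]; cbn.
- split; [intros H; exfalso; now apply (@emptyP M x)|intros [i [H _]]; lia].
- rewrite in_suc, IH; split.
  + intros [[i [Hi ->]]| ->]; [exists i|exists k]; auto.
  + intros [i [Hi ->]]; destruct (Nat.eq_dec i k) as [->|]; auto.
    left; exists i; split; auto; lia.
Qed.

Lemma num_inj i j : num i = num j -> i = j.
Proof.
assert (K : forall i j, i < j -> num i <> num j).
{ clear i j; intros i j Hij E; apply (@mem_irrefl M (num i)).
  rewrite E at 2; apply in_num; eauto. }
intros E; destruct (Nat.lt_trichotomy i j) as [H|[H|H]]; auto; exfalso;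
  [now apply (K i j)|now apply (K j i)].
Qed.

Lemma num_subset k l (x : V) : k <= l -> x ∈ num k -> x ∈ num l.
Proof.
intros H; rewrite !in_num; intros [i [Hi ->]]; exists i; split; auto; lia.
Qed.

Lemma def_function_on F t u : dterm t -> dterm u ->
  definable (M := M) (F := F) (fun i e => function_on (t i e) (u i e)).
Proof.
apply (def_pred2 (P := fun x y => function_on x y)).
unfold function_on, unique; dfn.
Qed.
Hint Resolve def_function_on : dfn.

Lemma def_equinumerous F t u : dterm t -> dterm u ->
  definable (M := M) (F := F) (fun i e => equinumerous (t i e) (u i e)).
Proof.
apply (def_pred2 (P := fun x y => equinumerous x y)).
unfold equinumerous, unique; dfn.
Qed.
Hint Resolve def_equinumerous : dfn.

Lemma def_finite F t : dterm t ->
  definable (M := M) (F := F) (fun i e => finite (t i e)).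
Proof.
apply (def_pred1 (P := fun x => finite x)); unfold finite; dfn.
Qed.

Lemma def_card_lt F t u : dterm t -> dterm u ->
  definable (M := M) (F := F) (fun i e => card_lt (t i e) (u i e)).
Proof.
apply (def_pred2 (P := fun x y => card_lt x y)); unfold card_lt; dfn.
Qed.

Lemma equinumerous_image (f : V -> V) (a : V) :
  dterm (F := full) (fun _ e => f (e 0)) ->
  (forall x y, x ∈ a -> y ∈ a -> f x = f y -> x = y) ->
  equinumerous a (image f a).
Proof.
intros Hf Hinj; assert (Hf' := fun t => @dterm_fun1 M full f t Hf).
assert (Hg : forall x y, ⟨x, y⟩ ∈ image (fun x => ⟨x, f x⟩) a <-> x ∈ a /\ y = f x).
{ intros x y; rewrite in_image by dfn; split.
  - intros [z [Hz E]]; apply opair_inj in E; destruct E; now subst.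
  - intros [Hx ->]; eauto. }
exists (image (fun x => ⟨x, f x⟩) a); split; [split|split].
- intros p Hp; apply in_image in Hp; [|dfn].
  destruct Hp as [x [Hx ->]]; eauto.
- intros x Hx; exists (f x); split; [now apply Hg|].
  intros y Hy; apply Hg in Hy; now symmetry.
- intros u v H; apply Hg in H; apply in_image; auto.
  destruct H as [H ->]; eauto.
- intros v Hv; apply in_image in Hv; auto; destruct Hv as [x [Hx ->]].
  exists x; split; [now apply Hg|].
  intros y Hy; apply Hg in Hy; destruct Hy as [Hy E]; now apply Hinj.
Qed.

Lemma finite_empty : finite (empty M).
Proof.
exists (empty M); split; [apply nat_empty|exists (empty M)].
repeat split; intros; exfalso; eapply (@emptyP M); eassumption.
Qed.

Lemma finite_adjoin (d d' x : V) :
  finite d -> (forall n, n ∈ d' <-> n ∈ d \/ n = x) -> finite d'.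
Proof.
intros Hd Hd'; destruct (classic (x ∈ d)) as [Hx|Hx].
{ replace d' with d; auto; apply set_ext; intros z; rewrite Hd'.
  split; [auto|intros [H| ->]; auto]. }
destruct Hd as [n [Hn [f [[Hf1 Hf2] [Hf3 Hf4]]]]].
exists (suc n); split; [now apply nat_suc|].
set (g := cup f (upair ⟨n, x⟩ ⟨n, x⟩)).
assert (Hg : forall u v, ⟨u, v⟩ ∈ g <-> ⟨u, v⟩ ∈ f \/ u = n /\ v = x).
{ intros u v; unfold g; rewrite in_cup, in_upair; split.
  - intros [H|[H|H]]; auto; apply opair_inj in H; auto.
  - intros [H|[-> ->]]; auto. }
assert (Hdom : forall u v, ⟨u, v⟩ ∈ f -> u ∈ n).
{ intros u v H; destruct (Hf1 _ H) as [u' [v' [Hu E]]].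
  apply opair_inj in E; destruct E; now subst. }
exists g; split; [split|split].
- intros p Hp; unfold g in Hp; rewrite in_cup, in_upair in Hp.
  destruct Hp as [Hp|Hp].
  + destruct (Hf1 p Hp) as [u [v [Hu ->]]]; exists u, v; split; auto.
    apply in_suc; auto.
  + exists n, x; split; [apply in_suc; auto|tauto].
- intros u Hu; apply in_suc in Hu; destruct Hu as [Hu| ->].
  + destruct (Hf2 u Hu) as [v [Hv Uv]]; exists v; split; [apply Hg; auto|].
    intros w Hw; apply Hg in Hw; destruct Hw as [Hw|[-> _]]; auto.
    exfalso; now apply (@mem_irrefl M n).
  + exists x; split; [apply Hg; auto|].
    intros w Hw; apply Hg in Hw; destruct Hw as [Hw|[_ ->]]; auto.
    exfalso; apply (@mem_irrefl M n); eauto.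
- intros u v H; apply Hg in H; apply Hd'; destruct H as [H|[_ ->]]; eauto.
- intros v Hv; apply Hd' in Hv; destruct Hv as [Hv| ->].
  + destruct (Hf4 v Hv) as [u [Hu Uu]]; exists u; split; [apply Hg; auto|].
    intros w Hw; apply Hg in Hw; destruct Hw as [Hw|[_ ->]]; auto.
    exfalso; now apply Hx.
  + exists n; split; [apply Hg; auto|].
    intros w Hw; apply Hg in Hw; destruct Hw as [Hw|[-> _]]; auto.
    exfalso; eauto.
Qed.

Lemma finite_subset_num k : forall x : V,
  (forall n, n ∈ x -> n ∈ num k) -> finite x.
Proof.
induction k as [|k IH]; intros x Hx.
- replace x with (empty M); [apply finite_empty|].
  symmetry; apply is_empty_iff; intros z Hz; apply (@emptyP M z), (Hx z Hz).
- destruct (@separation M (fun n => n <> num k) x) as [y Hy]; [dfn|].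
  assert (Fy : finite y).
  { apply IH; intros n Hn; apply Hy in Hn; destruct Hn as [Hn Hne].
    apply Hx in Hn; apply in_suc in Hn; tauto. }
  destruct (classic (num k ∈ x)) as [Hk|Hk].
  + apply (finite_adjoin (x := num k) Fy); intros n; rewrite Hy.
    destruct (classic (n = num k)) as [->|]; tauto.
  + replace x with y; auto; apply set_ext; intros z; rewrite Hy.
    split; [tauto|]; intros Hz; split; auto; now intros ->.
Qed.

Lemma finite_upair (x y : V) : finite (upair x y).
Proof.
apply (@finite_adjoin (upair x x) _ y).
- apply (@finite_adjoin (empty M) _ x); [apply finite_empty|].
  intros n; rewrite in_upair; split; [tauto|].
  intros [H|]; auto; exfalso; now apply (@emptyP M n).
- intros n; rewrite !in_upair; tauto.
Qed.

End Sizes.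

#[export] Hint Resolve dterm_suc def_is_nat dterm_num def_function_on
  def_equinumerous def_finite def_card_lt : dfn.

(** * Formulas and valuations *)

Ltac code_inv H :=
  let E := fresh "E" in
  unfold fEq, fMem, fIn, fNeg, fConj, fAll, fTr, fAnd in H;
  apply opair_inj in H; destruct H as [E H]; apply tag_inj in E;
  first [discriminate E
        | clear E;
          repeat (let K := fresh "E" in apply opair_inj in H; destruct H as [K H]);
          subst].

Section Formulas.
Variable M : gbc_model.
Local Notation V := (sets M).
Local Notation full := (full_frame M).
Local Notation "⟨ x , y ⟩" := (opair x y) (at level 0).

Lemma below_fNeg (φ : V) : below φ (fNeg φ).
Proof. apply below_opair_r. Qed.

Lemma below_fConj (Φ φ : V) : φ ∈ Φ -> below φ (fConj Φ).
Proof.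
intros H; apply below_trans with Φ; [now apply below_mem|apply below_opair_r].
Qed.

Lemma below_fAll (i φ : V) : below φ (fAll i φ).
Proof. apply below_trans with ⟨i, φ⟩; apply below_opair_r. Qed.

Lemma below_fAnd_l (φ ψ : V) : below φ (fAnd φ ψ).
Proof. apply below_trans with ⟨φ, ψ⟩; [apply below_opair_l|apply below_opair_r]. Qed.

Lemma below_fAnd_r (φ ψ : V) : below ψ (fAnd φ ψ).
Proof. apply below_trans with ⟨φ, ψ⟩; apply below_opair_r. Qed.

Section FormationStep.
Variable κ : V.

(** [inf_step] with a predicate in place of the set of pairs, so that it also
    applies to the proper class of all formulas. *)
Definition istep (Q : V -> V -> Prop) (φ s : V) : Prop :=
  (exists i j, is_nat i /\ is_nat j /\ φ = fEq i j /\ s = upair i j) \/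
  (exists i j, is_nat i /\ is_nat j /\ φ = fMem i j /\ s = upair i j) \/
  (exists i, is_nat i /\ φ = fIn i /\ s = upair i i) \/
  (exists ψ, φ = fNeg ψ /\ Q ψ s) \/
  (exists Φ, φ = fConj Φ /\ card_lt Φ κ /\
    (forall ψ, ψ ∈ Φ -> exists t, Q ψ t) /\
    (forall n, n ∈ s <-> exists ψ t, ψ ∈ Φ /\ Q ψ t /\ n ∈ t) /\ finite s) \/
  (exists i ψ t, φ = fAll i ψ /\ is_nat i /\ Q ψ t /\
    forall n, n ∈ s <-> n ∈ t /\ n <> i).

Lemma inf_step_iff (P φ s : V) :
  inf_step κ P φ s <-> istep (fun ψ t => ⟨ψ, t⟩ ∈ P) φ s.
Proof.
unfold istep; split.
- intros H; destruct H.
  + left; exists i, j; auto.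
  + right; left; exists i, j; auto.
  + do 2 right; left; exists i; auto.
  + do 3 right; left; exists φ; auto.
  + do 4 right; left; exists Φ; auto.
  + do 5 right; exists i, φ, t; auto.
- intros [[i [j [Hi [Hj [-> ->]]]]]|[[i [j [Hi [Hj [-> ->]]]]]|[[i [Hi [-> ->]]]|
    [[ψ [-> H]]|[[Φ [-> [H1 [H2 [H3 H4]]]]]|[i [ψ [t [-> [Hi [H1 H2]]]]]]]]]]].
  + now apply inf_eq.
  + now apply inf_mem.
  + now apply inf_in.
  + now apply inf_neg.
  + now apply inf_conj.
  + now apply inf_all with t.
Qed.

(** The conjunction rule is not simply positive in [Q]: it fixes [s] as the union of all recorded
    [t], so further records could enlarge the union. Uniqueness of the records in [Q'] excludes
    this. *)
Lemma istep_mono (Q Q' : V -> V -> Prop) (φ s : V) :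
  (forall ψ t, below ψ φ -> Q ψ t -> Q' ψ t) ->
  (forall ψ t t', below ψ φ -> Q' ψ t -> Q' ψ t' -> t = t') ->
  istep Q φ s -> istep Q' φ s.
Proof.
intros HQ Hfun; unfold istep.
intros [H|[H|[H|[[ψ [-> H]]|[[Φ [-> [H1 [H2 [H3 H4]]]]]|
  [i [ψ [t [-> [Hi [H1 H2]]]]]]]]]]]; try tauto.
- do 3 right; left; exists ψ; split; auto; apply HQ; auto; apply below_fNeg.
- assert (Hb : forall ψ, ψ ∈ Φ -> below ψ (fConj Φ)) by apply below_fConj.
  do 4 right; left; exists Φ; split; [|split; [|split; [|split]]]; auto.
  + intros ψ Hψ; destruct (H2 ψ Hψ) as [t Ht]; exists t; auto.
  + intros n; rewrite H3; split; intros [ψ [t [Hψ [Ht Hn]]]]; exists ψ.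
    * exists t; auto.
    * destruct (H2 ψ Hψ) as [t' Ht']; exists t'; repeat split; auto.
      rewrite (Hfun ψ t' t); auto.
- do 5 right; exists i, ψ, t; split; auto; split; auto; split; auto.
  apply HQ; auto; apply below_fAll.
Qed.

End FormationStep.

Lemma def_inf_formula F t u v : dterm t -> dterm u -> dterm v ->
  definable (M := M) (F := F) (fun i e => inf_formula (t i e) (u i e) (v i e)).
Proof.
apply (def_pred3 (P := fun κ φ s => inf_formula κ φ s)).
apply (@definable_iff M F (fun _ e => exists P, ⟨e 1, e 2⟩ ∈ P /\
  forall ψ t, ⟨ψ, t⟩ ∈ P -> istep (e 0) (fun ψ t => ⟨ψ, t⟩ ∈ P) ψ t)).
- intros _ e; unfold inf_formula; split; intros [P [H1 H2]]; exists P;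
    split; auto; intros; apply inf_step_iff; auto.
- unfold istep, fEq, fMem, fIn, fNeg, fConj, fAll; dfn.
Qed.
Hint Resolve def_inf_formula : dfn.

Section InfinitaryFormulas.
Variable κ : V.

Lemma inf_formula_unique : forall φ s s' : V,
  inf_formula κ φ s -> inf_formula κ φ s' -> s = s'.
Proof.
apply (@below_ind M (fun φ => forall s s', inf_formula κ φ s ->
  inf_formula κ φ s' -> s = s')); [dfn|].
intros φ IH s s' [P [HP P_step]] [P' [HP' P_step']].
assert (IH' : forall ψ t t', below ψ φ -> ⟨ψ, t⟩ ∈ P -> ⟨ψ, t'⟩ ∈ P' -> t = t').
{ intros ψ t t' Hψ H H'; apply (IH ψ Hψ); [now exists P|now exists P']. }
assert (H := P_step _ _ HP); assert (H' := P_step' _ _ HP').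
apply inf_step_iff in H; apply inf_step_iff in H'; unfold istep in H, H'.
destruct H as [[i [j [Hi [Hj [E ->]]]]]|[[i [j [Hi [Hj [E ->]]]]]|[[i [Hi [E ->]]]|
    [[ψ [E H]]|[[Φ [E [H1 [H2 [H3 H4]]]]]|[i [ψ [t [E [Hi [H1 H2]]]]]]]]]]];
destruct H' as [[i' [j' [Hi' [Hj' [E' ->]]]]]|[[i' [j' [Hi' [Hj' [E' ->]]]]]|
    [[i' [Hi' [E' ->]]]|[[ψ' [E' H']]|[[Φ' [E' [H1' [H2' [H3' H4']]]]]|
    [i' [ψ' [t' [E' [Hi' [H1' H2']]]]]]]]]]];
rewrite E in E'; code_inv E'; auto.
- apply (IH' ψ'); auto; apply below_fNeg.
- apply set_ext; intros n; rewrite H3, H3'.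
  split; intros [ψ [t [Hψ [Ht Hn]]]]; exists ψ.
  + destruct (H2' ψ Hψ) as [t' Ht']; exists t'; repeat split; auto.
    rewrite <- (IH' ψ t t'); auto; now apply below_fConj.
  + destruct (H2 ψ Hψ) as [t' Ht']; exists t'; repeat split; auto.
    rewrite (IH' ψ t' t); auto; now apply below_fConj.
- assert (t = t') by (apply (IH' ψ'); auto; apply below_fAll); subst.
  apply set_ext; intros n; now rewrite H2, H2'.
Qed.

(** Analyses of the subformulas need not be chosen and merged: as free variable sets are unique, all
    correct records for sets below [φ] form a set by replacement, and with the pair of [φ] and [s]
    they are an analysis of [φ]. *)
Lemma inf_formula_step (φ s : V) :
  inf_formula κ φ s <-> istep κ (inf_formula κ) φ s.
Proof.
assert (K : forall φ s, inf_formula κ φ s -> istep κ (inf_formula κ) φ s).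
{ clear φ s; intros φ s [P [HP P_step]].
  apply (@istep_mono κ (fun ψ t => ⟨ψ, t⟩ ∈ P)).
  - intros ψ t _ H; now exists P.
  - intros ψ t t' _; apply inf_formula_unique.
  - now apply inf_step_iff, P_step. }
split; auto; intros H.
destruct (@replacement M (fun ψ p => exists t, inf_formula κ ψ t /\ p = ⟨ψ, t⟩)
  (below_set φ)) as [P0 HP0]; [dfn| |].
{ intros ψ p p' [t [Ht ->]] [t' [Ht' ->]]; f_equal; now apply inf_formula_unique with ψ. }
set (P := cup P0 (upair ⟨φ, s⟩ ⟨φ, s⟩)).
assert (HP : forall ψ t, ⟨ψ, t⟩ ∈ P <->
  below ψ φ /\ inf_formula κ ψ t \/ ψ = φ /\ t = s).
{ intros ψ t; unfold P; rewrite in_cup, in_upair, HP0; split.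
  - intros [[z [Hz [w [Hw E]]]]|[E|E]]; apply opair_inj in E; destruct E; subst; auto.
    rewrite in_below_set in Hz; auto.
  - intros [[H1 H2]|[-> ->]]; auto; left; exists ψ; rewrite in_below_set; eauto. }
assert (HP' : forall ψ t, below ψ φ -> ⟨ψ, t⟩ ∈ P <-> inf_formula κ ψ t).
{ intros ψ t Hψ; rewrite HP; split; [|tauto].
  intros [[_ K']|[-> _]]; auto; exfalso; now apply (@below_irrefl M φ). }
assert (Kφ : forall ψ, ψ ∈ tc φ -> forall t, istep κ (inf_formula κ) ψ t ->
  istep κ (fun ψ t => ⟨ψ, t⟩ ∈ P) ψ t).
{ intros ψ Hψ t; assert (Hb : forall χ, below χ ψ -> below χ φ).
  { intros χ Hχ; apply tc_cases in Hψ; destruct Hψ as [->|Hψ]; auto.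
    now apply below_trans with ψ. }
  apply istep_mono.
  - intros χ u Hχ Hu; apply HP'; auto.
  - intros χ u u' Hχ Hu Hu'; apply HP' in Hu, Hu'; auto.
    now apply inf_formula_unique with χ. }
exists P; split; [apply HP; auto|].
intros ψ t Hψ; apply inf_step_iff; apply HP in Hψ.
destruct Hψ as [[Hψ Ht]|[-> ->]].
- apply Kφ; auto; apply tc_cases; auto.
- apply Kφ; auto; apply tc_refl.
Qed.

(** An external bound on the free variables, x_0 to x_{d-1}, spares the translation from computing
    them exactly. *)
Definition formula_in (d : nat) (φ : V) : Prop :=
  exists s, inf_formula κ φ s /\ forall n, n ∈ s -> n ∈ num M d.

Lemma formula_in_weaken d d' φ : d <= d' -> formula_in d φ -> formula_in d' φ.
Proof.
intros Hd [s [Hs H]]; exists s; split; auto.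
intros n Hn; apply num_subset with d; auto.
Qed.

Lemma in_num_lt i d : i < d -> num M i ∈ num M d.
Proof. intros; apply in_num; eauto. Qed.

Lemma formula_in_eq d i j : i < d -> j < d ->
  formula_in d (fEq (num M i) (num M j)).
Proof.
intros; exists (upair (num M i) (num M j)); split.
- apply inf_formula_step; left; exists (num M i), (num M j); auto using nat_num.
- intros n Hn; apply in_upair in Hn; destruct Hn; subst; now apply in_num_lt.
Qed.

Lemma formula_in_mem d i j : i < d -> j < d ->
  formula_in d (fMem (num M i) (num M j)).
Proof.
intros; exists (upair (num M i) (num M j)); split.
- apply inf_formula_step; right; left; exists (num M i), (num M j); auto using nat_num.
- intros n Hn; apply in_upair in Hn; destruct Hn; subst; now apply in_num_lt.
Qed.

Lemma formula_in_in d i : i < d -> formula_in d (fIn (num M i)).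
Proof.
intros; exists (upair (num M i) (num M i)); split.
- apply inf_formula_step; do 2 right; left; exists (num M i); auto using nat_num.
- intros n Hn; apply in_upair in Hn; destruct Hn; subst; now apply in_num_lt.
Qed.

Lemma formula_in_neg d φ : formula_in d φ -> formula_in d (fNeg φ).
Proof.
intros [s [Hs H]]; exists s; split; auto.
apply inf_formula_step; do 3 right; left; eauto.
Qed.

(** The condition on [d] and [d'] covers both later uses: the top variable is bound and the bound
    drops by one, or a lower variable is bound and [d' = d]. *)
Lemma formula_in_all d d' i φ : formula_in d φ ->
  (forall n, n ∈ num M d -> n ∈ num M d' \/ n = num M i) ->
  formula_in d' (fAll (num M i) φ).
Proof.
intros [s [Hs H]] Hd.
destruct (@separation M (fun n => n <> num M i) s) as [s' Hs']; [dfn|].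
exists s'; split.
- apply inf_formula_step; do 5 right; exists (num M i), φ, s; auto using nat_num.
- intros n Hn; apply Hs' in Hn; destruct Hn as [Hn Hne].
  destruct (Hd n); auto; tauto.
Qed.

(** The common bound [d] makes the free variables of all conjuncts together a finite set, as the
    formation rule demands. *)
Lemma formula_in_conj d Φ : card_lt Φ κ ->
  (forall φ, φ ∈ Φ -> formula_in d φ) -> formula_in d (fConj Φ).
Proof.
intros HΦ H.
destruct (@separation M (fun n => exists ψ t, ψ ∈ Φ /\ inf_formula κ ψ t /\ n ∈ t)
  (num M d)) as [s Hs]; [dfn|].
assert (Hsub : forall n, n ∈ s -> n ∈ num M d) by (intros n Hn; now apply Hs).
exists s; split; auto.
apply inf_formula_step; do 4 right; left; exists Φ.
split; [|split; [|split; [|split]]]; auto.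
- intros ψ Hψ; destruct (H ψ Hψ) as [t [Ht _]]; eauto.
- intros n; rewrite Hs; split; [tauto|].
  intros [ψ [t [Hψ [Ht Hn]]]]; split; [|eauto].
  destruct (H ψ Hψ) as [t' [Ht' K]]; apply K.
  now rewrite (@inf_formula_unique ψ t' t).
- now apply finite_subset_num with d.
Qed.

End InfinitaryFormulas.

Lemma def_formula_in κ d t : dterm t ->
  definable (F := full) (fun i e => formula_in κ d (t i e)).
Proof. apply (def_pred1 (P := formula_in κ d)); unfold formula_in; dfn. Qed.

(** * Valuations and their updates *)

Lemma def_valuation F t u : dterm t -> dterm u ->
  definable (M := M) (F := F) (fun i e => valuation (t i e) (u i e)).
Proof.
apply (def_pred2 (P := fun s a => valuation s a)); unfold valuation; dfn.
Qed.

Lemma def_is_update F t u v w : dterm t -> dterm u -> dterm v -> dterm w ->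
  definable (M := M) (F := F)
    (fun i e => is_update (t i e) (u i e) (v i e) (w i e)).
Proof.
apply (def_pred4 (P := fun a' a i b => is_update a' a i b)); unfold is_update; dfn.
Qed.

Lemma valuation_mono (s s' a : V) :
  (forall n, n ∈ s' -> n ∈ s) -> valuation s a -> valuation s' a.
Proof. intros H [d [H1 [H2 [H3 H4]]]]; exists d; auto 10. Qed.

Lemma valuation_fun (s a i x y : V) :
  valuation s a -> ⟨i, x⟩ ∈ a -> ⟨i, y⟩ ∈ a -> x = y.
Proof.
intros [d [_ [_ [_ [H1 H2]]]]] Hx Hy.
destruct (H1 _ Hx) as [i' [x' [Hi E]]]; apply opair_inj in E; destruct E; subst.
destruct (H2 i' Hi) as [z [_ Hz]]; transitivity z; [symmetry|]; auto.
Qed.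

Lemma update_exists (a i b : V) : exists a', is_update a' a i b.
Proof.
destruct (@separation M (fun p => forall y, p <> ⟨i, y⟩) a) as [c Hc]; [dfn|].
exists (cup (upair ⟨i, b⟩ ⟨i, b⟩) c); intros p.
rewrite in_cup, in_upair, Hc; tauto.
Qed.

Lemma update_eq (a' a i b : V) : is_update a' a i b -> ⟨i, b⟩ ∈ a'.
Proof. intros H; apply H; auto. Qed.

Lemma update_neq (a' a i b j y : V) :
  is_update a' a i b -> j <> i -> ⟨j, y⟩ ∈ a -> ⟨j, y⟩ ∈ a'.
Proof.
intros H Hj Hy; apply H; right; split; auto.
intros z E; apply opair_inj in E; tauto.
Qed.

Lemma valuation_update (s s' a a' i b : V) :
  valuation s a -> is_nat i -> is_update a' a i b ->
  (forall n, n ∈ s' -> n ∈ s \/ n = i) -> valuation s' a'.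
Proof.
intros [d [Fd [Nd [Sd [H1 H2]]]]] Hi Ha' Hs'.
assert (Hin : forall n, n ∈ cup d (upair i i) <-> n ∈ d \/ n = i)
  by (intros n; rewrite in_cup, in_upair; tauto).
exists (cup d (upair i i)); split; [|split; [|split; [|split]]].
- now apply (finite_adjoin (x := i) Fd).
- intros n Hn; apply Hin in Hn; destruct Hn; subst; auto.
- intros n Hn; apply Hin; destruct (Hs' n Hn); auto.
- intros p Hp; apply Ha' in Hp; destruct Hp as [->|[Hp _]].
  + exists i, b; split; auto; apply Hin; auto.
  + destruct (H1 p Hp) as [x [y [Hx ->]]]; exists x, y; split; auto; apply Hin; auto.
- intros x Hx; destruct (classic (x = i)) as [->|Hne].
  + exists b; split; [now apply update_eq with a|].
    intros y Hy; apply Ha' in Hy; destruct Hy as [E|[_ Hy]].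
    * apply opair_inj in E; now symmetry.
    * exfalso; now apply (Hy y).
  + apply Hin in Hx; destruct Hx as [Hx|]; [|tauto].
    destruct (H2 x Hx) as [y [Hy Uy]]; exists y; split.
    * now apply update_neq with a i b.
    * intros z Hz; apply Ha' in Hz; destruct Hz as [E|[Hz _]]; auto.
      apply opair_inj in E; tauto.
Qed.

End Formulas.

#[export] Hint Resolve def_inf_formula def_formula_in def_valuation def_is_update : dfn.

(** * Infinitary definitions of the stages *)

Section Translation.
Variable M : gbc_model.
Local Notation V := (sets M).
Local Notation full := (full_frame M).
Local Notation "⟨ x , y ⟩" := (opair x y) (at level 0).

(** Expresses ¬φ[x_j/x_i] without substituting. *)
Definition bind (i j : nat) (φ : V) : V :=
  fAll (num M i) (fNeg (fConj (upair (fEq (num M i) (num M j)) φ))).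

Section Code.
(** Class variables [n] with [k n = true] stand for the class [A], the others
    for a class whose complement is defined by the conjunction of [Z], a set of
    formulas in the variable [x_0]. *)
Variable k : nat -> bool.

(** [ρ] sends de Bruijn indices to variables and [d] is the next fresh variable. The variable x_0 is
    reserved for the formulas in [Z], so [ρ] takes positive values. As [bind] negates and [Z]
    defines a complement, the class atom comes out positive. *)
Fixpoint code (Z : V) (f : pfml) (ρ : nat -> nat) (d : nat) : V :=
  match f with
  | PEq i j => fEq (num M (ρ i)) (num M (ρ j))
  | PMem i j => fMem (num M (ρ i)) (num M (ρ j))
  | PCls i n => if k n then fIn (num M (ρ i)) else bind 0 (ρ i) (fConj Z)
  | PNeg g => fNeg (code Z g ρ d)
  | PAnd g h => fConj (upair (code Z g ρ d) (code Z h ρ d))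
  | PAll g => fAll (num M d) (code Z g (scons d ρ) (S d))
  end.

Lemma dterm_code F f : forall ρ d t, dterm t ->
  dterm (M := M) (F := F) (fun i e => code (t i e) f ρ d).
Proof.
induction f as [i j|i j|i n|g IH|g IHg h IHh|g IH]; intros ρ d t Ht; cbn;
  unfold fEq, fMem, fIn, fNeg, fConj, fAll; try solve [dfn].
destruct (k n); unfold bind, fEq, fIn, fNeg, fConj, fAll; dfn.
Qed.

End Code.
Hint Resolve dterm_code : dfn.

(** * Formation and truth of the translated formulas *)

Variables (κ : V) (A T : classes M).
Hypothesis κ_uncountable : uncountable_cardinal κ.
Hypothesis T_truth : truth_predicate κ A T.

Lemma mem_κ_trans x y : x ∈ κ -> y ∈ x -> y ∈ κ.
Proof. destruct κ_uncountable as [[[H1 H2] _] _]; eauto. Qed.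

Lemma κ_trichotomy x y : x ∈ κ -> y ∈ κ -> x ∈ y \/ x = y \/ y ∈ x.
Proof. destruct κ_uncountable as [[[H1 H2] _] _]; eauto. Qed.

Lemma nat_mem_κ n : is_nat n -> n ∈ κ.
Proof.
intros Hn; destruct κ_uncountable as [_ [w [Hw Kw]]].
apply mem_κ_trans with w; auto; now apply Hw.
Qed.

Lemma finite_card_lt x : finite x -> card_lt x κ.
Proof. intros [n [Hn H]]; exists n; split; auto; now apply nat_mem_κ. Qed.

Lemma formula_in_conj2 d φ ψ : formula_in κ d φ -> formula_in κ d ψ ->
  formula_in κ d (fConj (upair φ ψ)).
Proof.
intros H1 H2; apply formula_in_conj.
- apply finite_card_lt, finite_upair.
- intros χ H; apply in_upair in H; destruct H; now subst.
Qed.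

Lemma formula_in_bind d d' i j φ : i < d -> j < d -> formula_in κ d φ ->
  (forall n, n ∈ num M d -> n ∈ num M d' \/ n = num M i) ->
  formula_in κ d' (bind i j φ).
Proof.
intros Hi Hj H Hd; apply formula_in_all with d; auto.
now apply formula_in_neg, formula_in_conj2; [apply formula_in_eq|].
Qed.

Lemma formula_in_valuation d φ a :
  formula_in κ d φ -> valuation (num M d) a -> inf_valuation κ φ a.
Proof.
intros [s [Hs Hd]] Ha; exists s; split; auto; now apply valuation_mono with (num M d).
Qed.

Lemma true_conj2 d φ ψ a : formula_in κ d φ -> formula_in κ d ψ ->
  valuation (num M d) a ->
  ⟨fConj (upair φ ψ), a⟩ ∈c T <-> ⟨φ, a⟩ ∈c T /\ ⟨ψ, a⟩ ∈c T.
Proof.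
intros H1 H2 Ha; rewrite (tp_conj T_truth).
- split.
  + intros H; split; apply H, in_upair; auto.
  + intros [K1 K2] χ H; apply in_upair in H; destruct H; now subst.
- apply formula_in_valuation with d; auto; now apply formula_in_conj2.
Qed.

(** The equation inside [bind] is false unless x_i receives the value [x] of x_j, so a single update
    matters, and there [φ] has the truth value [R]. The condition [i <> j] keeps x_j intact under
    the update. *)
Lemma true_bind d d' i j φ a x (R : Prop) :
  i < d -> j < d -> j < d' -> i <> j -> formula_in κ d φ ->
  (forall n, n ∈ num M d -> n ∈ num M d' \/ n = num M i) ->
  valuation (num M d') a -> ⟨num M j, x⟩ ∈ a ->
  (forall a', valuation (num M d) a' -> is_update a' a (num M i) x ->
    (⟨φ, a'⟩ ∈c T <-> R)) ->
  ⟨bind i j φ, a⟩ ∈c T <-> ~ R.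
Proof.
intros Hi Hj Hj' Hij Hφ Hd Ha Hx HR.
assert (Hconj : formula_in κ d (fConj (upair (fEq (num M i) (num M j)) φ)))
  by now apply formula_in_conj2; [apply formula_in_eq|].
assert (Hupd : forall b a', is_update a' a (num M i) b -> valuation (num M d) a')
  by (intros b a' H; apply (valuation_update Ha (@nat_num M i) H Hd)).
assert (E : forall b a', is_update a' a (num M i) b ->
  ⟨fNeg (fConj (upair (fEq (num M i) (num M j)) φ)), a'⟩ ∈c T <->
  ~ (b = x /\ ⟨φ, a'⟩ ∈c T)).
{ intros b a' H.
  rewrite (tp_neg T_truth), (@true_conj2 d); eauto using formula_in_eq.
  - rewrite (tp_eq T_truth (x := b) (y := x)); [tauto| | |].
    + apply formula_in_valuation with d; eauto using formula_in_eq.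
    + now apply update_eq with a.
    + apply (update_neq H); auto.
      intros K; apply num_inj in K; auto.
  - apply formula_in_valuation with d; eauto using formula_in_neg. }
unfold bind; rewrite (tp_all T_truth).
- split.
  + intros H; destruct (update_exists a (num M i) x) as [a' Ha'].
    specialize (H x a' Ha'); apply (E x a' Ha') in H.
    intros r; apply H; split; auto; apply HR; eauto.
  + intros nR b a' Ha'; apply (E b a' Ha'); intros [-> K]; apply nR.
    apply (HR a'); eauto.
- apply formula_in_valuation with d'; auto; now apply formula_in_bind with d.
Qed.

Section CodeTruth.
Variables (k : nat -> bool) (Z : V) (X : classes M).
Hypothesis Z_formula : formula_in κ 1 (fConj Z).
Hypothesis Z_true : forall a x, valuation (num M 1) a -> ⟨num M 0, x⟩ ∈ a ->
  ⟨fConj Z, a⟩ ∈c T <-> ~ x ∈c X.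

Lemma code_formula f : forall ρ d, 1 <= d -> (forall i, 1 <= ρ i < d) ->
  formula_in κ d (code k Z f ρ d).
Proof.
induction f as [i j|i j|i n|g IH|g IHg h IHh|g IH]; intros ρ d Hd Hρ; cbn.
- apply formula_in_eq; apply Hρ.
- apply formula_in_mem; apply Hρ.
- destruct (k n); [apply formula_in_in, Hρ|].
  apply formula_in_bind with d; auto; [apply Hρ|now apply formula_in_weaken with 1].
- apply formula_in_neg; auto.
- apply formula_in_conj2; auto.
- apply formula_in_all with (S d).
  + apply IH; [lia|]; intros [|i]; cbn; [lia|specialize (Hρ i); lia].
  + intros n Hn; now apply in_suc in Hn.
Qed.

Lemma true_code f : forall ρ d a e, 1 <= d -> (forall i, 1 <= ρ i < d) ->
  valuation (num M d) a -> (forall i, ⟨num M (ρ i), e i⟩ ∈ a) ->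
  ⟨code k Z f ρ d, a⟩ ∈c T <-> psat (fun n => if k n then A else X) e f.
Proof.
induction f as [i j|i j|i n|g IH|g IHg h IHh|g IH];
  intros ρ d a e Hd Hρ Ha He;
  match goal with |- ⟨code k Z ?f ρ d, a⟩ ∈c T <-> _ =>
    assert (Hv := formula_in_valuation (code_formula f Hd Hρ) Ha) end;
  cbn in Hv |- *.
- now apply (tp_eq T_truth).
- now apply (tp_mem T_truth).
- destruct (k n); [now apply (tp_in T_truth)|].
  (* [R] is non-membership, because [Z] defines the complement of [X]; the negation in [bind]
     cancels it classically. *)
  rewrite (@true_bind d d 0 (ρ i) (fConj Z) a (e i) (~ e i ∈c X)); auto;
    try apply Hρ; try lia.
  + split; [apply NNPP|tauto].
  + specialize (Hρ i); lia.
  + now apply formula_in_weaken with 1.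
  + intros a' Ha' Hu; apply Z_true; [|now apply update_eq with a].
    apply valuation_mono with (num M d); auto; intros m; now apply num_subset.
- rewrite (tp_neg T_truth), IH; eauto; tauto.
- rewrite (@true_conj2 d); auto using code_formula.
  now rewrite (IHg ρ d a e), (IHh ρ d a e).
- rewrite (tp_all T_truth); auto.
  assert (Hρ' : forall i, 1 <= scons d ρ i < S d)
    by (intros [|i]; cbn; [lia|specialize (Hρ i); lia]).
  assert (E : forall b a', is_update a' a (num M d) b ->
    ⟨code k Z g (scons d ρ) (S d), a'⟩ ∈c T <->
    psat (fun n => if k n then A else X) (scons b e) g).
  { intros b a' Hu; apply IH; auto.
    - apply (valuation_update Ha (@nat_num M d) Hu); intros n; apply in_suc.
    - intros [|i]; cbn; [now apply update_eq with a|].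
      apply (update_neq Hu); auto.
      intros K; apply num_inj in K; specialize (Hρ i); lia. }
  split.
  + intros H b; destruct (update_exists a (num M d) b) as [a' Ha'].
    apply (E b a'); auto; now apply H with b.
  + intros H b a' Ha'; now apply (E b a').
Qed.

End CodeTruth.

(** * The formulas N_t and the stages they define *)

Section Stages.
Variables (k : nat -> bool) (f : pfml).

(** Says of [x_0] that [f] fails for it and that it is not in the class whose
    complement is defined by [Z]. *)
Definition stage_code (Z : V) : V :=
  fConj (upair (bind 1 0 (code k Z f (fun _ => 1) 2)) (fConj Z)).

Lemma dterm_stage_code t : dterm t ->
  dterm (F := full) (fun i e => stage_code (t i e)).
Proof. intros; unfold stage_code, bind, fConj, fAll, fNeg, fEq; dfn. Qed.

Variable N : V -> V.
Hypothesis N_def : dterm (F := full) (fun _ e => N (e 0)).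
Hypothesis N_rec : forall t, N t = stage_code (image N t).

Lemma dterm_N t : dterm t -> dterm (F := full) (fun i e => N (t i e)).
Proof. now apply dterm_fun1. Qed.
Hint Resolve dterm_N : dfn.

Lemma dterm_imageN t : dterm t -> dterm (F := full) (fun i e => image N (t i e)).
Proof.
intros; apply (@dterm_image M (fun _ => N) (fun i e => t i e) t); auto.
apply dterm_N, dterm_var.
Qed.
Hint Resolve dterm_imageN : dfn.

Lemma in_imageN y t : y ∈ image N t <-> exists s, s ∈ t /\ y = N s.
Proof. apply in_image; dfn. Qed.

(** All conjunctions from which [N t] is built have fewer than [κ] members. *)
Definition admissible (t : V) : Prop :=
  forall s, s ∈ tc t -> card_lt (image N s) κ.

Lemma def_admissible t : dterm t ->
  definable (F := full) (fun i e => admissible (t i e)).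
Proof. apply (def_pred1 (P := admissible)); unfold admissible; dfn. Qed.
Hint Resolve def_admissible : dfn.

Lemma admissible_mem s t : admissible t -> s ∈ t -> admissible s.
Proof. intros Ht Hs r Hr; apply Ht; now apply tc_step with s. Qed.

Lemma admissible_intro t :
  (forall s, s ∈ t -> admissible s) -> card_lt (image N t) κ -> admissible t.
Proof.
intros H Ht s Hs; apply tc_cases in Hs; destruct Hs as [->|[z [Hz Hs]]]; auto.
now apply (H z).
Qed.

(** For [z ∈ t] the code [N z] is a conjunct inside [N t]. Hence [N] is injective on any chain of
    [below], which is how conjunctions will be counted. *)
Lemma below_N : forall t s, below s t -> below (N s) (N t).
Proof.
apply (@mem_ind M (fun t => forall s, below s t -> below (N s) (N t))); [dfn|].
intros t IH s [z [Hz Hs]].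
assert (Hzt : below (N z) (N t)).
{ rewrite (N_rec t); unfold stage_code.
  apply below_trans with (fConj (image N t)).
  - apply below_fConj, in_imageN; eauto.
  - apply below_fConj, in_upair; auto. }
apply tc_cases in Hs; destruct Hs as [->|Hs]; auto.
apply below_trans with (N z); auto.
Qed.

Definition singleton_valuation (p : V) : V := upair ⟨num M 0, p⟩ ⟨num M 0, p⟩.

Lemma singleton_valuation_in p : ⟨num M 0, p⟩ ∈ singleton_valuation p.
Proof. apply in_upair; auto. Qed.

Lemma singleton_valuationP p : valuation (num M 1) (singleton_valuation p).
Proof.
exists (num M 1); split; [|split; [|split; [|split]]]; auto.
- now apply finite_subset_num with 1.
- intros n Hn; apply in_num in Hn; destruct Hn as [i [_ ->]]; apply nat_num.
- intros q Hq; exists (num M 0), p; split; [apply in_num; exists 0; auto|].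
  apply in_upair in Hq; tauto.
- intros x Hx; apply in_num in Hx; destruct Hx as [i [Hi ->]].
  replace i with 0 by lia; exists p; split; [apply singleton_valuation_in|].
  intros y Hy; apply in_upair in Hy.
  destruct Hy as [E|E]; apply opair_inj in E; now symmetry.
Qed.

(** [N t] defines the complement of the stage. *)
Definition in_stage (t p : V) : Prop := ~ ⟨N t, singleton_valuation p⟩ ∈c T.

Lemma def_in_stage t u : dterm t -> dterm u ->
  definable (F := full) (fun i e => in_stage (t i e) (u i e)).
Proof.
apply (def_pred2 (P := in_stage)); unfold in_stage, singleton_valuation; dfn.
Qed.
Hint Resolve def_in_stage : dfn.

(** [in_stage] consults one particular valuation, whereas inside [bind] the formula is evaluated at
    valuations with further variables; soundness says that only the value of x_0 matters. *)
Definition stage_sound (t : V) : Prop :=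
  formula_in κ 1 (N t) /\
  forall a x, valuation (num M 1) a -> ⟨num M 0, x⟩ ∈ a ->
    ⟨N t, a⟩ ∈c T <-> ~ in_stage t x.

Lemma stage_unfold t X : card_lt (image N t) κ ->
  (forall s, s ∈ t -> stage_sound s) ->
  (forall p, p ∈c X <-> exists s, s ∈ t /\ in_stage s p) ->
  formula_in κ 1 (N t) /\
  forall a x, valuation (num M 1) a -> ⟨num M 0, x⟩ ∈ a ->
    ⟨N t, a⟩ ∈c T <->
    ~ psat (fun n => if k n then A else X) (fun _ => x) f /\ ~ x ∈c X.
Proof.
intros Ht IH HX; set (Z := image N t).
assert (Z_formula : formula_in κ 1 (fConj Z)).
{ apply formula_in_conj; auto; intros φ Hφ; apply in_imageN in Hφ.
  destruct Hφ as [s [Hs ->]]; now apply IH. }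
assert (Z_true : forall a x, valuation (num M 1) a -> ⟨num M 0, x⟩ ∈ a ->
  ⟨fConj Z, a⟩ ∈c T <-> ~ x ∈c X).
{ intros a x Ha Hx; rewrite (tp_conj T_truth), HX.
  - split.
    + intros H [s [Hs Hin]].
      assert (K := H (N s)); apply IH with (x := x) in K; auto.
      apply in_imageN; eauto.
    + intros H φ Hφ; apply in_imageN in Hφ; destruct Hφ as [s [Hs ->]].
      apply (proj2 (IH s Hs)) with x; auto; intros K; apply H; eauto.
  - now apply formula_in_valuation with 1. }
assert (Hbody : formula_in κ 2 (code k Z f (fun _ => 1) 2))
  by (apply code_formula; auto; lia).
assert (Hnum : forall n, n ∈ num M 2 -> n ∈ num M 1 \/ n = num M 1)
  by (intros n; apply in_suc).
assert (Hbind : formula_in κ 1 (bind 1 0 (code k Z f (fun _ => 1) 2)))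
  by (apply formula_in_bind with 2; auto; lia).
rewrite N_rec; fold Z; split; [now apply formula_in_conj2|].
intros a x Ha Hx; unfold stage_code; rewrite (@true_conj2 1), Z_true with (x := x); auto.
(* As [code] keeps x_0 for [Z], the argument is moved from x_0 to x_1. All free indices of [f] are
   sent to x_1, whence the constant assignment [x]. *)
rewrite (@true_bind 2 1 1 0 _ a x
  (psat (fun n => if k n then A else X) (fun _ => x) f)); auto; try tauto.
intros a' Ha' Hu; apply true_code; auto; try lia.
intros _; now apply update_eq with a.
Qed.

Lemma stage_class t : exists X : classes M,
  forall p, p ∈c X <-> exists s, s ∈ t /\ in_stage s p.
Proof. apply comprehension; dfn. Qed.

(** [stage_unfold] gives a condition on [x] that does not mention the valuation; comparing it at [a]
    and at the singleton valuation yields soundness at [t]. *)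
Lemma admissible_sound : forall t, admissible t -> stage_sound t.
Proof.
apply (@mem_ind M (fun t => admissible t -> stage_sound t));
  [unfold stage_sound; dfn|].
intros t IH Ht; destruct (stage_class t) as [X HX].
destruct (@stage_unfold t X) as [H1 H2]; auto.
- apply Ht, tc_refl.
- intros s Hs; apply IH; auto; now apply admissible_mem with t.
- split; auto; intros a x Ha Hx; unfold in_stage.
  rewrite (H2 a x Ha Hx), (H2 _ x (singleton_valuationP x) (singleton_valuation_in x)).
  tauto.
Qed.

(** The recursion equation of the stages, with truth of infinitary formulas eliminated from the
    right-hand side; the argument about claims rests on it. *)
Lemma in_stage_iff t X p : admissible t ->
  (forall q, q ∈c X <-> exists s, s ∈ t /\ in_stage s q) ->
  in_stage t p <->
  psat (fun n => if k n then A else X) (fun _ => p) f \/ p ∈c X.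
Proof.
intros Ht HX; destruct (@stage_unfold t X) as [_ H]; auto.
- apply Ht, tc_refl.
- intros s Hs; apply admissible_sound; now apply admissible_mem with t.
- unfold in_stage; rewrite (H _ p (singleton_valuationP p) (singleton_valuation_in p)).
  split; [intros K; apply NNPP|]; tauto.
Qed.

End Stages.
End Translation.

(** * Sets indexing the stages *)

Section Towers.
Variable M : gbc_model.
Local Notation V := (sets M).
Local Notation full := (full_frame M).

(** The recursion step for towers: the set of earlier values is empty exactly at the bottom, where
    the base [x] takes its place. *)
Definition default_if_empty (x Z : V) : V :=
  if excluded_middle_informative (Z = empty M) then x else Z.

Lemma dterm_default_if_empty :
  dterm (F := full) (fun _ e => default_if_empty (e 0) (e 1)).
Proof.
apply (@definable_iff M full (fun _ e => (e 2 = empty M /\ e 0 = e 1) \/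
  (e 2 <> empty M /\ e 0 = e 2))); [|dfn].
intros _ e; unfold default_if_empty.
destruct (excluded_middle_informative (e 2 = empty M)); tauto.
Qed.

(** A copy of [n] stacked on [x]: stages are indexed by such sets instead of
    ordinals because their members are visibly in bijection with [n], so that
    no cardinal arithmetic below [κ] is needed. *)
Lemma tower_exists : exists tower : V -> V -> V,
  dterm (F := full) (fun _ e => tower (e 0) (e 1)) /\
  (forall x, tower x (empty M) = x) /\
  (forall x n, (exists m, m ∈ n) ->
    forall s, s ∈ tower x n <-> exists m, m ∈ n /\ s = tower x m).
Proof.
destruct (recursion dterm_default_if_empty) as [tower [D H]].
assert (Him : forall x n s, s ∈ image (tower x) n <->
  exists m, m ∈ n /\ s = tower x m).
{ intros; apply in_image.
  exact (@dterm_fun2 M full tower _ _ D (dterm_const _) (dterm_var _ _)). }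
exists tower; split; [|split]; auto.
- intros x; rewrite H; unfold default_if_empty.
  destruct (excluded_middle_informative _) as [|Hne]; auto; exfalso; apply Hne.
  apply is_empty_iff; intros s Hs; apply Him in Hs.
  destruct Hs as [m [Hm _]]; now apply (@emptyP M m).
- intros x n [m Hm] s; rewrite H; unfold default_if_empty.
  destruct (excluded_middle_informative _) as [He|]; [|apply Him].
  exfalso; apply (@emptyP M (tower x m)); rewrite <- He; apply Him; eauto.
Qed.

Section Stages.
Variables (κ w : V) (tower : V -> V -> V) (level : V -> V).
Hypothesis κ_uncountable : uncountable_cardinal κ.
Hypothesis w_omega : is_omega w.
Hypothesis w_mem : w ∈ κ.
Hypothesis tower_def : dterm (F := full) (fun _ e => tower (e 0) (e 1)).
Hypothesis tower_empty : forall x, tower x (empty M) = x.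
Hypothesis in_tower : forall x n, (exists m, m ∈ n) ->
    forall s, s ∈ tower x n <-> exists m, m ∈ n /\ s = tower x m.
Hypothesis level_def : dterm (F := full) (fun _ e => level (e 0)).
Hypothesis level_rec : forall β, level β = tower (image level β) w.

Lemma dterm_tower t t' : dterm t -> dterm t' ->
  dterm (F := full) (fun i e => tower (t i e) (t' i e)).
Proof. now apply dterm_fun2. Qed.

Lemma dterm_level t : dterm t -> dterm (F := full) (fun i e => level (t i e)).
Proof. now apply dterm_fun1. Qed.

Lemma dterm_image_level t : dterm t -> dterm (F := full) (fun i e => image level (t i e)).
Proof.
intros; apply (@dterm_image M (fun _ => level) t t); auto; apply dterm_level, dterm_var.
Qed.
Hint Resolve dterm_tower dterm_level dterm_image_level : dfn.

Lemma in_image_level s β : s ∈ image level β <-> exists α, α ∈ β /\ s = level α.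
Proof. apply in_image; dfn. Qed.

Lemma tower_mem x m n : m ∈ n -> tower x m ∈ tower x n.
Proof. intros H; apply in_tower; eauto. Qed.

Lemma tower_mem_level β n : is_nat n -> tower (image level β) n ∈ level β.
Proof. intros H; rewrite (level_rec β); now apply tower_mem, w_omega. Qed.

(** The base [image level β] contains [level α], and as the tower of height 0 it is itself a member
    of [level β]. *)
Lemma below_level α β : α ∈ β -> below (level α) (level β).
Proof.
intros H; apply below_trans with (image level β).
- apply below_mem, in_image_level; eauto.
- apply below_mem; rewrite <- (tower_empty (image level β)) at 1.
  apply tower_mem_level, nat_empty.
Qed.

Section Admissible.
Variables (N : V -> V).
Hypothesis N_def : dterm (F := full) (fun _ e => N (e 0)).
Hypothesis N_below : forall t s, below s t -> below (N s) (N t).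

(** Members of [n] are comparable, being ordinals below [κ], and [h] followed by [N] is strictly
    increasing for [below], hence injective. So [n] itself witnesses the size. *)
Lemma card_lt_image_image (h : V -> V) (n : V) :
  dterm (F := full) (fun _ e => h (e 0)) -> n ∈ κ ->
  (forall m m', m' ∈ n -> m ∈ m' -> below (h m) (h m')) ->
  card_lt (image N (image h n)) κ.
Proof.
intros Hh Hn Hbelow; exists n; split; auto.
assert (Hh' := fun t => @dterm_fun1 M full h t Hh).
assert (N_def' := fun t => @dterm_fun1 M full N t N_def).
replace (image N (image h n)) with (image (fun m => N (h m)) n).
- apply equinumerous_image; [dfn|]; intros m m' Hm Hm' E.
  destruct (κ_trichotomy κ_uncountable (x := m) (y := m')) as [H|[H|H]]; auto;
    try (now apply mem_κ_trans with n); exfalso.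
  + apply (@below_irrefl M (N (h m))); rewrite E at 2; auto.
  + apply (@below_irrefl M (N (h m))); rewrite E at 1; auto.
- apply set_ext; intros y; rewrite !in_image by dfn; split.
  + intros [m [Hm ->]]; exists (h m); split; auto; apply in_image; eauto.
  + intros [z [Hz ->]]; apply in_image in Hz; auto.
    destruct Hz as [m [Hm ->]]; eauto.
Qed.

Lemma admissible_tower x : admissible κ N x ->
  forall n, n ∈ κ -> admissible κ N (tower x n).
Proof.
intros Hx.
assert (D := fun t => @def_admissible M κ N N_def t).
apply (@mem_ind M (fun n => n ∈ κ -> admissible κ N (tower x n))); [dfn|].
intros n IH Hn; destruct (classic (exists m, m ∈ n)) as [Hne|He].
- apply admissible_intro.
  + intros s Hs; apply in_tower in Hs; auto; destruct Hs as [m [Hm ->]].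
    apply IH; auto; now apply mem_κ_trans with n.
  + replace (tower x n) with (image (tower x) n).
    * apply card_lt_image_image; [dfn| |]; auto.
      intros m m' _ H; now apply below_mem, tower_mem.
    * apply set_ext; intros s; rewrite in_tower, in_image by (dfn || auto); tauto.
- replace n with (empty M); [now rewrite tower_empty|].
  symmetry; apply is_empty_iff; intros m Hm; eauto.
Qed.

Lemma admissible_level : forall β, β ∈ κ ->
  admissible κ N (image level β) /\ admissible κ N (level β).
Proof.
assert (D := fun t => @def_admissible M κ N N_def t).
apply (@mem_ind M (fun β => β ∈ κ ->
  admissible κ N (image level β) /\ admissible κ N (level β))); [dfn|].
intros β IH Hβ.
assert (H : admissible κ N (image level β)).
{ apply admissible_intro.
  - intros s Hs; apply in_image_level in Hs; destruct Hs as [α [Hα ->]].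
    apply IH; auto; now apply mem_κ_trans with β.
  - apply card_lt_image_image; auto; intros; now apply below_level. }
split; auto; rewrite level_rec; now apply admissible_tower.
Qed.

End Admissible.
End Stages.
End Towers.

(** * Clauses and claims *)

Section Clauses.
Variable M : gbc_model.
Local Notation V := (sets M).
Local Notation full := (full_frame M).
Local Notation "⟨ x , y ⟩" := (opair x y) (at level 0).

Variable A : classes M.

(** The defining clauses of an iterated truth predicate, with [Yp] in place of
    the predicate and [Yn] in place of its negation. *)
Definition clause (β φ a : V) (Yp Yn : V -> V -> V -> Prop) : Prop :=
  (exists i j x, φ = fEq i j /\ ⟨i, x⟩ ∈ a /\ ⟨j, x⟩ ∈ a) \/
  (exists i j x y, φ = fMem i j /\ ⟨i, x⟩ ∈ a /\ ⟨j, y⟩ ∈ a /\ x ∈ y) \/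
  (exists i x, φ = fIn i /\ ⟨i, x⟩ ∈ a /\ x ∈c A) \/
  (exists i j l x y z, φ = fTr i j l /\ ⟨i, x⟩ ∈ a /\ ⟨j, y⟩ ∈ a /\ ⟨l, z⟩ ∈ a /\
    x ∈ β /\ fo_valuation y z /\ Yp x y z) \/
  (exists ψ, φ = fNeg ψ /\ Yn β ψ a) \/
  (exists ψ χ, φ = fAnd ψ χ /\ Yp β ψ a /\ Yp β χ a) \/
  (exists i ψ, φ = fAll i ψ /\ forall b a', is_update a' a i b -> Yp β ψ a').

Definition immediate (ψ φ : V) : Prop :=
  φ = fNeg ψ \/ (exists χ, φ = fAnd ψ χ \/ φ = fAnd χ ψ) \/ exists i, φ = fAll i ψ.

(** What a clause may consult: the truth atom reaches arbitrary formulas at lower levels,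
    connectives and quantifiers only immediate subformulas at the same level. *)
Definition smaller (α ψ β φ : V) : Prop := α ∈ β \/ α = β /\ immediate ψ φ.

Lemma immediate_below ψ φ : immediate ψ φ -> below ψ φ.
Proof.
intros [->|[[χ [->| ->]]|[i ->]]].
- apply below_fNeg.
- apply below_fAnd_l.
- apply below_fAnd_r.
- apply below_fAll.
Qed.

(** * Passing from first-order formulas to their subformulas *)

Lemma fo_formula_neg (φ s : V) : fo_formula (fNeg φ) s -> fo_formula φ s.
Proof.
intros [P [HP P_step]]; assert (H := P_step _ _ HP).
inversion H as [i j ? ? E|i j ? ? E|i ? E|i j l ? ? ? ? ? E|ψ ? ? E|
  ψ χ ? ? ? ? ? ? E|i ψ ? ? ? ? ? E]; code_inv E.
now exists P.
Qed.

Lemma fo_formula_and (φ ψ s : V) : fo_formula (fAnd φ ψ) s ->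
  (exists t, fo_formula φ t /\ forall n, n ∈ t -> n ∈ s) /\
  (exists t, fo_formula ψ t /\ forall n, n ∈ t -> n ∈ s).
Proof.
intros [P [HP P_step]]; assert (H := P_step _ _ HP).
inversion H as [i j ? ? E|i j ? ? E|i ? E|i j l ? ? ? ? ? E|ψ' ? ? E|
  ψ' χ ? t u Ht Hu Hs E|i ψ' ? ? ? ? ? E]; code_inv E.
split; [exists t|exists u]; split; try (now exists P); intros n Hn; apply Hs; auto.
Qed.

Lemma fo_formula_all (i φ s : V) : fo_formula (fAll i φ) s ->
  is_nat i /\ exists t, fo_formula φ t /\ forall n, n ∈ t -> n ∈ s \/ n = i.
Proof.
intros [P [HP P_step]]; assert (H := P_step _ _ HP).
inversion H as [? j ? ? E|? j ? ? E|? ? E|? j l ? ? ? ? ? E|ψ' ? ? E|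
  ψ' χ ? t u Ht Hu Hs E|i' ψ' ? t Hi Ht Hs E]; code_inv E.
split; auto; exists t; split; [now exists P|].
intros n Hn; destruct (classic (n = i)); auto; left; now apply Hs.
Qed.

Lemma fo_valuation_neg (φ a : V) : fo_valuation (fNeg φ) a -> fo_valuation φ a.
Proof. intros [s [Hs Ha]]; exists s; split; auto; now apply fo_formula_neg. Qed.

Lemma fo_valuation_and (φ ψ a : V) : fo_valuation (fAnd φ ψ) a ->
  fo_valuation φ a /\ fo_valuation ψ a.
Proof.
intros [s [Hs Ha]]; apply fo_formula_and in Hs.
destruct Hs as [[t [Ht Hts]] [t' [Ht' Hts']]].
split; [exists t|exists t']; split; auto; now apply valuation_mono with s.
Qed.

Lemma fo_valuation_all (i φ a a' b : V) : fo_valuation (fAll i φ) a ->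
  is_update a' a i b -> fo_valuation φ a'.
Proof.
intros [s [Hs Ha]] Hu; apply fo_formula_all in Hs.
destruct Hs as [Hi [t [Ht Hts]]]; exists t; split; auto.
exact (valuation_update Ha Hi Hu Hts).
Qed.

Lemma immediate_fo (ψ φ s : V) : immediate ψ φ -> fo_formula φ s ->
  exists t, fo_formula ψ t.
Proof.
intros [->|[[χ [->| ->]]|[i ->]]] H.
- exists s; now apply fo_formula_neg.
- apply fo_formula_and in H; destruct H as [[t [H _]] _]; eauto.
- apply fo_formula_and in H; destruct H as [_ [t [H _]]]; eauto.
- apply fo_formula_all in H; destruct H as [_ [t [H _]]]; eauto.
Qed.

(** Both monotonicity and dependence on smaller pairs only. In the truth atom the values [y], [z]
    are arbitrary sets; the conjunct [fo_valuation y z] of [clause] confines it to pairs covered by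
    the hypothesis. *)
Lemma clause_local (β φ a : V) (Yp Yn Yp' Yn' : V -> V -> V -> Prop) :
  fo_valuation φ a ->
  (forall α ψ b, smaller α ψ β φ -> fo_valuation ψ b ->
    (Yp α ψ b -> Yp' α ψ b) /\ (Yn α ψ b -> Yn' α ψ b)) ->
  clause β φ a Yp Yn -> clause β φ a Yp' Yn'.
Proof.
intros Ha H; unfold clause.
intros [K|[K|[K|[K|[K|[K|K]]]]]]; try tauto.
- destruct K as [i [j [l [x [y [z [-> [Hx [Hy [Hz [Hxβ [Hyz K]]]]]]]]]]]].
  do 3 right; left; exists i, j, l, x, y, z; repeat split; auto.
  apply H; auto; now left.
- destruct K as [ψ [-> K]]; do 4 right; left; exists ψ; split; auto.
  apply H; auto; [|now apply fo_valuation_neg].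
  right; split; auto; now left.
- destruct K as [ψ [χ [-> [K1 K2]]]]; do 5 right; left; exists ψ, χ; split; auto.
  apply fo_valuation_and in Ha; destruct Ha as [Ha1 Ha2].
  split; apply H; auto; right; split; auto; right; left; eauto.
- destruct K as [i [ψ [-> K]]]; do 6 right; exists i, ψ; split; auto.
  intros b a' Hu; apply H; eauto; [|now apply fo_valuation_all with i a b].
  right; split; auto; right; right; eauto.
Qed.

(** * Evaluation of the clauses by the form of the formula *)

Section ClauseCases.
Variables (β a s : V) (Yp Yn : V -> V -> V -> Prop).
Hypothesis a_valuation : valuation s a.

Ltac clause_cases H :=
  destruct H as [H|[H|[H|[H|[H|[H|H]]]]]];
  repeat match type of H with exists _, _ => destruct H as [? H] end;
  let E := fresh "E" in destruct H as [E H]; code_inv E.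

Ltac value_eq :=
  match goal with
  | H : ⟨?i, ?x⟩ ∈ a, H' : ⟨?i, ?y⟩ ∈ a |- _ =>
      assert_fails (constr_eq x y); assert (x = y)
        by exact (valuation_fun a_valuation H H'); subst
  end.

Lemma clause_eq i j x y : ⟨i, x⟩ ∈ a -> ⟨j, y⟩ ∈ a ->
  clause β (fEq i j) a Yp Yn <-> x = y.
Proof.
intros Hx Hy; split.
- intros H; clause_cases H; destruct H; now repeat value_eq.
- intros ->; left; eauto 10.
Qed.

Lemma clause_mem i j x y : ⟨i, x⟩ ∈ a -> ⟨j, y⟩ ∈ a ->
  clause β (fMem i j) a Yp Yn <-> x ∈ y.
Proof.
intros Hx Hy; split.
- intros H; clause_cases H; destruct H as [? [? ?]]; now repeat value_eq.
- intros H; right; left; exists i, j, x, y; auto.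
Qed.

Lemma clause_in i x : ⟨i, x⟩ ∈ a ->
  clause β (fIn i) a Yp Yn <-> x ∈c A.
Proof.
intros Hx; split.
- intros H; clause_cases H; destruct H; now repeat value_eq.
- intros H; do 2 right; left; exists i, x; auto.
Qed.

Lemma clause_tr i j l x y z : ⟨i, x⟩ ∈ a -> ⟨j, y⟩ ∈ a -> ⟨l, z⟩ ∈ a ->
  clause β (fTr i j l) a Yp Yn <-> x ∈ β /\ fo_valuation y z /\ Yp x y z.
Proof.
intros Hx Hy Hz; split.
- intros H; clause_cases H; destruct H as [? [? [? ?]]]; now repeat value_eq.
- intros H; do 3 right; left; exists i, j, l, x, y, z; auto.
Qed.

Lemma clause_neg φ : clause β (fNeg φ) a Yp Yn <-> Yn β φ a.
Proof.
split.
- intros H; clause_cases H; auto.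
- intros H; do 4 right; left; eauto.
Qed.

Lemma clause_and φ ψ :
  clause β (fAnd φ ψ) a Yp Yn <-> Yp β φ a /\ Yp β ψ a.
Proof.
split.
- intros H; clause_cases H; auto.
- intros H; do 5 right; left; eauto.
Qed.

Lemma clause_all i φ : clause β (fAll i φ) a Yp Yn <->
  forall b a', is_update a' a i b -> Yp β φ a'.
Proof.
split.
- intros H; clause_cases H; auto.
- intros H; do 6 right; eauto.
Qed.

End ClauseCases.

(** A claim states that [φ] is true ([c = 0]) or false ([c = 1]) of [a] at
    level [β]. *)
Definition claim (c : nat) (β φ a : V) : V := ⟨tag M c, ⟨β, ⟨φ, a⟩⟩⟩.

Lemma claim_inj c c' β β' φ φ' a a' : claim c β φ a = claim c' β' φ' a' ->
  c = c' /\ β = β' /\ φ = φ' /\ a = a'.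
Proof.
intros H; apply opair_inj in H; destruct H as [E H]; apply tag_inj in E.
apply opair_inj in H; destruct H as [E1 H]; apply opair_inj in H; tauto.
Qed.

(** Negating [clause] with the roles of the two kinds of claims exchanged keeps
    this positive in [P]. *)
Definition settles (P : V -> Prop) (p : V) : Prop :=
  exists β φ a, fo_valuation φ a /\
    ((p = claim 0 β φ a /\
      clause β φ a (fun α ψ b => P (claim 0 α ψ b)) (fun α ψ b => P (claim 1 α ψ b))) \/
     (p = claim 1 β φ a /\
      ~ clause β φ a (fun α ψ b => ~ P (claim 1 α ψ b))
                     (fun α ψ b => ~ P (claim 0 α ψ b)))).

Lemma settles_mono (P Q : V -> Prop) p :
  (forall q, P q -> Q q) -> settles P p -> settles Q p.
Proof.
intros H [β [φ [a [Ha K]]]]; exists β, φ, a; split; auto.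
destruct K as [[-> K]|[-> K]]; [left|right]; split; auto.
- revert K; apply clause_local; auto.
- intros K'; apply K; revert K'; apply clause_local; auto.
Qed.

Lemma settles_true P β φ a : settles P (claim 0 β φ a) ->
  clause β φ a (fun α ψ b => P (claim 0 α ψ b)) (fun α ψ b => P (claim 1 α ψ b)).
Proof.
intros [β' [φ' [a' [_ [[E H]|[E H]]]]]]; apply claim_inj in E;
  destruct E as [E [-> [-> ->]]]; [auto|discriminate].
Qed.

Lemma settles_false P β φ a : settles P (claim 1 β φ a) ->
  ~ clause β φ a (fun α ψ b => ~ P (claim 1 α ψ b))
                 (fun α ψ b => ~ P (claim 0 α ψ b)).
Proof.
intros [β' [φ' [a' [_ [[E H]|[E H]]]]]]; apply claim_inj in E;
  destruct E as [E [-> [-> ->]]]; [discriminate|auto].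
Qed.

Lemma def_fo_formula F t t' : dterm t -> dterm t' ->
  definable (M := M) (F := F) (fun i e => fo_formula (t i e) (t' i e)).
Proof.
apply (def_pred2 (P := fun φ s => fo_formula φ s)).
apply (@definable_iff M F (fun _ e => exists P, ⟨e 0, e 1⟩ ∈ P /\
  forall ψ s, ⟨ψ, s⟩ ∈ P ->
  (exists i j, is_nat i /\ is_nat j /\ ψ = fEq i j /\ s = upair i j) \/
  (exists i j, is_nat i /\ is_nat j /\ ψ = fMem i j /\ s = upair i j) \/
  (exists i, is_nat i /\ ψ = fIn i /\ s = upair i i) \/
  (exists i j l, is_nat i /\ is_nat j /\ is_nat l /\ ψ = fTr i j l /\
    forall n, n ∈ s <-> n = i \/ n = j \/ n = l) \/
  (exists χ, ψ = fNeg χ /\ ⟨χ, s⟩ ∈ P) \/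
  (exists χ χ' t u, ψ = fAnd χ χ' /\ ⟨χ, t⟩ ∈ P /\ ⟨χ', u⟩ ∈ P /\
    forall n, n ∈ s <-> n ∈ t \/ n ∈ u) \/
  (exists i χ t, ψ = fAll i χ /\ is_nat i /\ ⟨χ, t⟩ ∈ P /\
    forall n, n ∈ s <-> n ∈ t /\ n <> i))).
- intros _ e; unfold fo_formula; split; intros [P [H1 H2]]; exists P; split; auto;
    intros ψ s Hψ; specialize (H2 ψ s Hψ).
  + destruct H2 as [[i [j [Hi [Hj [-> ->]]]]]|[[i [j [Hi [Hj [-> ->]]]]]|
      [[i [Hi [-> ->]]]|[[i [j [l [Hi [Hj [Hl [-> Hs]]]]]]]|[[χ [-> H]]|
      [[χ [χ' [v [v' [-> [H [H' Hs]]]]]]]|[i [χ [v [-> [Hi [H Hs]]]]]]]]]]]].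
    * now apply fo_eq.
    * now apply fo_mem.
    * now apply fo_in.
    * now apply fo_tr.
    * now apply fo_neg.
    * now apply fo_and with v v'.
    * now apply fo_all with v.
  + destruct H2 as [i j|i j|i|i j l|χ|χ χ' s v v'|i χ s v].
    * left; exists i, j; auto.
    * right; left; exists i, j; auto.
    * do 2 right; left; exists i; auto.
    * do 3 right; left; exists i, j, l; auto.
    * do 4 right; left; exists χ; auto.
    * do 5 right; left; exists χ, χ', v, v'; auto.
    * do 6 right; exists i, χ, v; auto.
- unfold fEq, fMem, fIn, fNeg, fAnd, fAll, fTr; dfn.
Qed.
Hint Resolve def_fo_formula : dfn.

Lemma def_fo_valuation F t t' : dterm t -> dterm t' ->
  definable (M := M) (F := F) (fun i e => fo_valuation (t i e) (t' i e)).
Proof.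
apply (def_pred2 (P := fun φ s => fo_valuation φ s)); unfold fo_valuation; dfn.
Qed.
Hint Resolve def_fo_valuation : dfn.

Lemma dterm_claim F c t t' t'' : dterm t -> dterm t' -> dterm t'' ->
  dterm (F := F) (fun i e => claim c (t i e) (t' i e) (t'' i e)).
Proof. unfold claim; dfn. Qed.
Hint Resolve dterm_claim : dfn.

(** Stated for any frame: one use needs a formula uniform in a class variable, another definability
    of an induction predicate in the full frame. *)
Lemma def_settles F (P : index F -> V -> Prop) t :
  (forall t, dterm t -> definable (F := F) (fun i e => t i e ∈c A)) ->
  (forall t, dterm t -> definable (F := F) (fun i e => P i (t i e))) ->
  dterm t -> definable (F := F) (fun i e => settles (P i) (t i e)).
Proof.
intros HA HP Ht.
apply (@def_subst M F t (fun i p _ => settles (P i) p)); auto.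
unfold settles, clause, fEq, fMem, fIn, fNeg, fAnd, fAll, fTr; dfn.
Qed.

(** Definability is taken in the frame indexed by the class [X] with two parameters, [true] denoting
    [A] and [false] denoting [X]. The formula found is therefore the same for all [X], as the
    recursion defining [N] requires. *)
Lemma settles_formula : exists (f : pfml) (k : nat -> bool),
  forall X p, psat (fun n => if k n then A else X) (fun _ => p) f <->
    settles (fun q => q ∈c X) p.
Proof.
set (F := @Frame M (classes M) bool (fun b X => if b then A else X) true).
destruct (@def_settles F (fun X q => q ∈c X) (fun _ e => e 0)) as [f [k E]].
- intros t; exact (@def_cls M F true t).
- intros t; exact (@def_cls M F false t).
- apply dterm_var.
- exists f, k; intros X p; exact (E X (fun _ => p)).
Qed.

(** Lexicographic: ∈-induction on the level, and within it induction along [below] on the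
    formula. *)
Lemma smaller_induction (κ : V) (Q : V -> V -> Prop) :
  (forall β α, β ∈ κ -> α ∈ β -> α ∈ κ) ->
  definable (F := full) (fun _ e => Q (e 0) (e 1)) ->
  (forall β φ s, β ∈ κ -> fo_formula φ s ->
    (forall α ψ t, smaller α ψ β φ -> fo_formula ψ t -> α ∈ κ /\ Q α ψ) -> Q β φ) ->
  forall β φ s, β ∈ κ -> fo_formula φ s -> Q β φ.
Proof.
intros κ_trans HQ IH; assert (HQ' := fun t u => @def_pred2 M full Q t u HQ).
apply (@mem_ind M (fun β => forall φ s, β ∈ κ -> fo_formula φ s -> Q β φ)); [dfn|].
intros β IHβ φ s Hβ; revert φ s.
apply (@below_ind M (fun φ => forall s, fo_formula φ s -> Q β φ)); [dfn|].
intros φ IHφ s Hφ; apply IH with s; auto.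
intros α ψ t [Hα|[-> H]] Hψ.
- split; eauto.
- split; auto; apply IHφ with t; auto; now apply immediate_below.
Qed.

End Clauses.

#[export] Hint Resolve def_fo_formula def_fo_valuation dterm_claim : dfn.

(** * The iterated truth predicate *)

Section Iteration.
Variable M : gbc_model.
Local Notation V := (sets M).
Local Notation full := (full_frame M).
Local Notation "⟨ x , y ⟩" := (opair x y) (at level 0).

Variables (κ w : V) (A : classes M).
Hypothesis κ_uncountable : uncountable_cardinal κ.
Hypothesis w_omega : is_omega w.

Variables (admissible : V -> Prop) (stage : V -> V -> Prop).
Hypothesis admissible_def : forall t, dterm t ->
  definable (F := full) (fun i e => admissible (t i e)).
Hypothesis stage_def : forall t t', dterm t -> dterm t' ->
  definable (F := full) (fun i e => stage (t i e) (t' i e)).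
Hypothesis admissible_mem : forall s t, admissible t -> s ∈ t -> admissible s.
Hypothesis stage_iff : forall t p, admissible t ->
  stage t p <->
  settles A (fun q => exists s, s ∈ t /\ stage s q) p \/
  exists s, s ∈ t /\ stage s p.

Variables (tower : V -> V -> V) (level : V -> V).
Hypothesis tower_def : dterm (F := full) (fun _ e => tower (e 0) (e 1)).
Hypothesis tower_empty : forall x, tower x (empty M) = x.
Hypothesis in_tower : forall x n, (exists m, m ∈ n) ->
    forall s, s ∈ tower x n <-> exists m, m ∈ n /\ s = tower x m.
Hypothesis level_def : dterm (F := full) (fun _ e => level (e 0)).
Hypothesis level_rec : forall β, level β = tower (image level β) w.
Hypothesis admissible_tower : forall β n, β ∈ κ -> n ∈ κ ->
  admissible (tower (image level β) n).
Hypothesis admissible_level : forall β, β ∈ κ -> admissible (level β).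

Let dterm_tower' := dterm_tower tower_def.
Let dterm_image_level' := dterm_image_level level_def.
Hint Resolve admissible_def stage_def dterm_tower' dterm_image_level' : dfn.

Definition settled (p : V) : Prop := exists t, admissible t /\ stage t p.

Lemma def_settled t : dterm t ->
  definable (F := full) (fun i e => settled (t i e)).
Proof. apply (def_pred1 (P := settled)); unfold settled; dfn. Qed.
Hint Resolve def_settled : dfn.

Lemma stage_step s t p : admissible t -> s ∈ t -> stage s p -> stage t p.
Proof. intros Ht Hs Hp; apply stage_iff; eauto. Qed.

(** By ∈-induction on the stage: a claim in it is justified by claims of earlier stages, all of
    which are settled, or already occurs in an earlier stage. *)
Lemma settled_settles p : settled p -> settles A settled p.
Proof.
intros [t [Ht Hp]]; revert t Ht p Hp.
assert (D : forall t, dterm t ->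
  definable (F := full) (fun i e => settles A settled (t i e))).
{ intros t; apply (@def_settles M A full (fun _ => settled)); intros; dfn. }
apply (@mem_ind M (fun t => admissible t -> forall p, stage t p ->
  settles A settled p)); [dfn|].
intros t IH Ht p Hp; apply stage_iff in Hp; auto; destruct Hp as [Hp|[s [Hs Hp]]].
- revert Hp; apply settles_mono; intros q [s [Hs Hq]]; exists s; eauto.
- eauto.
Qed.

Definition decided_at (t β φ : V) : Prop :=
  forall a, fo_valuation φ a -> stage t (claim 0 β φ a) \/ stage t (claim 1 β φ a).

Lemma decided_at_mono s t β φ :
  admissible t -> s ∈ t -> decided_at s β φ -> decided_at t β φ.
Proof.
intros Ht Hs H a Ha; destruct (H a Ha); [left|right]; now apply stage_step with s.
Qed.

(** The bound [n] on the stage is uniform in the valuation: this is needed to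
    settle universal quantifications over all sets. *)
Definition decided (β φ : V) : Prop :=
  exists n, is_nat n /\ decided_at (tower (image level β) n) β φ.

Definition consistent (β φ : V) : Prop :=
  forall a, fo_valuation φ a ->
    ~ (settled (claim 0 β φ a) /\ settled (claim 1 β φ a)).

(** Places the base of a tower among the members of the tower of height [suc n]; comparability in
    [κ] replaces an induction on [n]. *)
Lemma empty_in_suc (n : V) : is_nat n -> empty M ∈ suc n.
Proof.
intros Hn; destruct (κ_trichotomy κ_uncountable (x := empty M) (y := suc n))
  as [H|[H|H]]; auto; try (apply nat_mem_κ; auto using nat_empty, nat_suc).
- exfalso; apply (@emptyP M n); rewrite H; apply in_suc; auto.
- exfalso; now apply (@emptyP M (suc n)).
Qed.

Lemma decided_common (β φ ψ : V) : β ∈ κ -> decided β φ -> decided β ψ ->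
  exists n, is_nat n /\ decided_at (tower (image level β) n) β φ /\
    decided_at (tower (image level β) n) β ψ.
Proof.
intros Hβ [n [Hn H]] [m [Hm H']].
assert (Hmono : forall n m χ, is_nat m -> n ∈ m ->
  decided_at (tower (image level β) n) β χ -> decided_at (tower (image level β) m) β χ).
{ intros i j χ Hj Hij; apply decided_at_mono.
  - apply admissible_tower; auto; now apply nat_mem_κ.
  - now apply (tower_mem in_tower). }
destruct (κ_trichotomy κ_uncountable (x := n) (y := m)) as [K|[K|K]];
  try (now apply nat_mem_κ).
- exists m; eauto.
- subst; eauto.
- exists n; eauto.
Qed.

(** A formula has at most two immediate subformulas, so the larger of two bounds serves; for atomic
    formulas 0 does. *)
Lemma decided_immediate (β φ s : V) : β ∈ κ -> fo_formula φ s ->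
  (forall ψ, immediate ψ φ -> decided β ψ) ->
  exists n, is_nat n /\
    forall ψ, immediate ψ φ -> decided_at (tower (image level β) n) β ψ.
Proof.
intros Hβ Hφ H.
destruct (classic (exists ψ, immediate ψ φ)) as [[ψ Hψ]|Hno].
- destruct Hψ as [->|[[χ Hψ]|[i ->]]].
  + destruct (H ψ) as [n [Hn K]]; [now left|].
    exists n; split; auto; intros ψ' [E|[[χ [E|E]]|[i E]]]; code_inv E; auto.
  + assert (Hor : exists ψ χ, φ = fAnd ψ χ) by (destruct Hψ; eauto).
    clear ψ χ Hψ; destruct Hor as [ψ [χ ->]].
    destruct (@decided_common β ψ χ) as [n [Hn [K1 K2]]]; auto;
      try (apply H; right; left; eauto).
    exists n; split; auto; intros ψ' [E|[[χ' [E|E]]|[i E]]]; code_inv E; auto.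
  + destruct (H ψ) as [n [Hn K]]; [right; right; eauto|].
    exists n; split; auto; intros ψ' [E|[[χ [E|E]]|[j E]]]; code_inv E; auto.
- exists (empty M); split; [apply nat_empty|]; intros ψ Hψ; exfalso; eauto.
Qed.

(** If the smaller pairs are decided, one of the two claims is justified; if they are consistent,
    the two justifications exclude each other. *)
Lemma decided_and_consistent (β φ s : V) : β ∈ κ -> fo_formula φ s ->
  decided β φ /\ consistent β φ.
Proof.
revert β φ s.
apply (@smaller_induction M κ (fun β φ => decided β φ /\ consistent β φ)).
{ intros β α; now apply mem_κ_trans. }
{ unfold decided, consistent, decided_at; dfn. }
intros β φ s Hβ Hφ IH; split.
- destruct (@decided_immediate β φ s) as [m [Hm Hdec]]; auto.
  { intros ψ Hψ; destruct (immediate_fo Hψ Hφ) as [t Ht].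
    apply (IH β ψ t); auto; now right. }
  set (t := tower (image level β) (suc m)).
  assert (Hsuc : is_nat (suc m)) by now apply nat_suc.
  assert (Ht : admissible t) by (apply admissible_tower; auto; now apply nat_mem_κ).
  exists (suc m); split; auto; fold t.
  set (P := fun q => exists s, s ∈ t /\ stage s q).
  assert (HP : forall α ψ b, smaller α ψ β φ -> fo_valuation ψ b ->
    P (claim 0 α ψ b) \/ P (claim 1 α ψ b)).
  { assert (Hu : image level β ∈ t).
    { rewrite <- (tower_empty (image level β)); apply (tower_mem in_tower).
      now apply empty_in_suc. }
    intros α ψ b Hs Hb; destruct Hs as [Hα|[-> Hψ]].
    - destruct Hb as [r [Hr Hb]].
      destruct (IH α ψ r) as [_ [[n [Hn Hd]] _]]; [now left|auto|].
      assert (Hα' : α ∈ κ) by now apply mem_κ_trans with β.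
      (* For a lower level the claim climbs along memberships: the tower of height [n] is in
         [level α], which is in [image level β], which is in [t]. *)
      assert (K : forall q, stage (tower (image level α) n) q -> P q).
      { intros q Hq; exists (image level β); split; auto.
        apply stage_step with (level α); [now apply admissible_mem with t| |].
        - apply in_image_level; eauto.
        - apply stage_step with (tower (image level α) n); auto.
          now apply (tower_mem_level w_omega in_tower level_rec). }
      destruct (Hd b); [now exists r|left|right]; auto.
    - assert (K : forall q, stage (tower (image level β) m) q -> P q).
      { intros q Hq; exists (tower (image level β) m); split; auto.
        apply (tower_mem in_tower), in_suc; auto. }
      destruct (Hdec ψ Hψ b Hb); [left|right]; auto. }
  intros a Ha.
  destruct (classic (clause A β φ a (fun α ψ b => P (claim 0 α ψ b))
    (fun α ψ b => P (claim 1 α ψ b)))) as [Hc|Hc]; [left|right];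
    apply stage_iff; auto; left; exists β, φ, a; split; auto.
  (* By [HP], where one claim on a smaller pair is missing the opposite one is present. So the
     clause read with missing claims implies the clause read with present ones, which fails. *)
  right; split; auto; intros K; apply Hc; revert K; apply clause_local; auto.
  intros α ψ b Hs Hb; specialize (HP α ψ b Hs Hb); unfold P in *; tauto.
(* The justification of the true claim uses settled claims; by consistency their opposites are
   unsettled, so the same clause holds in the form that the false claim denies. *)
- intros a Ha [H0 H1].
  apply settled_settles, settles_true in H0.
  apply settled_settles, settles_false in H1.
  apply H1; revert H0; apply clause_local; auto.
  intros α ψ b Hs Hb; assert (Hb' := Hb); destruct Hb' as [r [Hr _]].
  destruct (IH α ψ r Hs Hr) as [_ [_ Hc]]; specialize (Hc b Hb); tauto.
Qed.

Lemma settled_total (β φ a : V) : β ∈ κ -> fo_valuation φ a ->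
  settled (claim 0 β φ a) \/ settled (claim 1 β φ a).
Proof.
intros Hβ Ha; assert (Ha' := Ha); destruct Ha' as [s [Hs _]].
destruct (decided_and_consistent Hβ Hs) as [[n [Hn H]] _].
assert (Hn' : n ∈ κ) by now apply nat_mem_κ.
destruct (H a Ha); [left|right]; exists (tower (image level β) n); auto.
Qed.

Lemma settled_consistent (β φ a : V) : β ∈ κ -> fo_valuation φ a ->
  settled (claim 0 β φ a) -> settled (claim 1 β φ a) -> False.
Proof.
intros Hβ Ha; assert (Ha' := Ha); destruct Ha' as [s [Hs _]].
destruct (decided_and_consistent Hβ Hs) as [_ H]; specialize (H a Ha); tauto.
Qed.

Lemma iterated_truth_exists :
  exists Tr : classes M, iterated_truth_predicate κ A Tr.
Proof.
destruct (@comprehension M (fun p => exists β φ a, β ∈ κ /\ fo_valuation φ a /\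
  p = ⟨β, ⟨φ, a⟩⟩ /\ settled (claim 0 β φ a))) as [Tr HTr]; [dfn|].
set (Y := fun β φ a => ⟨β, ⟨φ, a⟩⟩ ∈c Tr).
assert (HY : forall β φ a, β ∈ κ -> fo_valuation φ a ->
  Y β φ a <-> settled (claim 0 β φ a)).
{ intros β φ a Hβ Ha; unfold Y; rewrite HTr; split; [|eauto 10].
  intros [β' [φ' [a' [_ [_ [E H]]]]]].
  apply opair_inj in E; destruct E as [-> E]; apply opair_inj in E.
  now destruct E as [-> ->]. }
assert (Hsm : forall β α φ ψ, β ∈ κ -> smaller α ψ β φ -> α ∈ κ).
{ intros β α φ ψ Hβ [H|[-> _]]; auto; now apply mem_κ_trans with β. }
assert (Hclause : forall β φ a, β ∈ κ -> fo_valuation φ a ->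
  Y β φ a <-> clause A β φ a Y (fun α ψ b => ~ Y α ψ b)).
{ intros β φ a Hβ Ha; split.
  - intros H; apply HY, settled_settles, settles_true in H; auto.
    revert H; apply clause_local; auto; intros α ψ b Hs Hb.
    assert (Hα := Hsm _ _ _ _ Hβ Hs); rewrite (HY α ψ b) by auto.
    assert (K := settled_consistent Hα Hb); tauto.
  (* Otherwise totality settles the false claim, and its justification contradicts the clause. *)
  - intros H; apply NNPP; intros nY; rewrite HY in nY by auto.
    destruct (settled_total Hβ Ha) as [|K]; auto.
    apply settled_settles, settles_false in K; apply K; clear K nY.
    revert H; apply clause_local; auto; intros α ψ b Hs Hb.
    assert (Hα := Hsm _ _ _ _ Hβ Hs); rewrite (HY α ψ b) by auto.
    assert (K := settled_consistent Hα Hb); tauto. }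
assert (Hclause' : forall β φ a, β ∈ κ -> fo_valuation φ a ->
  exists s, valuation s a /\
    (⟨β, ⟨φ, a⟩⟩ ∈c Tr <-> clause A β φ a Y (fun α ψ b => ~ Y α ψ b))).
{ intros β φ a Hβ Ha; assert (Hv := Ha); destruct Hv as [s [_ Hv]].
  exists s; split; auto; now apply Hclause. }
exists Tr; split.
- intros p Hp; apply HTr in Hp; destruct Hp as [β [φ [a [H1 [H2 [H3 _]]]]]].
  exists β, φ, a; auto.
- intros β i j a x y Hβ Ha Hx Hy; destruct (Hclause' _ _ _ Hβ Ha) as [s [Hs ->]].
  now apply clause_eq with s.
- intros β i j a x y Hβ Ha Hx Hy; destruct (Hclause' _ _ _ Hβ Ha) as [s [Hs ->]].
  now apply clause_mem with s.
- intros β i a x Hβ Ha Hx; destruct (Hclause' _ _ _ Hβ Ha) as [s [Hs ->]].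
  now apply clause_in with s.
- intros β i j l a x y z Hβ Ha Hx Hy Hz.
  destruct (Hclause' _ _ _ Hβ Ha) as [s [Hs ->]].
  rewrite (clause_tr A β Y _ Hs Hx Hy Hz); split; [intros [H1 [H2 H3]]; auto|].
  (* The side condition [fo_valuation y z] is recovered from membership in [Tr], whose elements all
     satisfy it. *)
  intros [H1 H2]; split; [auto|split; [|exact H2]].
  apply HTr in H2; destruct H2 as [x' [y' [z' [_ [H2 [E _]]]]]].
  apply opair_inj in E; destruct E as [_ E]; apply opair_inj in E.
  now destruct E as [-> ->].
- intros β φ ψ a Hβ Ha; destruct (Hclause' _ _ _ Hβ Ha) as [s [_ ->]].
  now rewrite clause_and.
- intros β φ a Hβ Ha; destruct (Hclause' _ _ _ Hβ Ha) as [s [_ ->]].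
  now rewrite clause_neg.
- intros β i φ a Hβ Ha; destruct (Hclause' _ _ _ Hβ Ha) as [s [_ ->]].
  now rewrite clause_all.
Qed.

End Iteration.

Theorem theorem20 (M : gbc_model) (A : classes M) (κ : sets M)
    (hκ : uncountable_cardinal κ) :
  (exists T : classes M, truth_predicate κ A T) ->
  exists Tr : classes M, iterated_truth_predicate κ A Tr.
Proof.
intros [T HT]; assert (Hw := hκ); destruct Hw as [_ [w [w_omega w_mem]]].
destruct (@settles_formula M A) as [f [k Hf]].
destruct (@recursion M (fun _ Z => stage_code k f Z)) as [N' [N'_def N'_rec]].
{ apply (dterm_stage_code k f (dterm_var _ 1)). }
set (N := N' (empty M)).
assert (N_def : dterm (F := full_frame M) (fun _ e => N (e 0)))
  by exact (dterm_fun2 N'_def (dterm_const _) (dterm_var _ _)).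
assert (N_rec : forall t, N t = stage_code k f (image N t))
  by (intros t; apply N'_rec).
assert (N_below := below_N N_def N_rec).
destruct (tower_exists M) as [tower [tower_def [tower_empty in_tower]]].
destruct (@recursion M (fun _ Z => tower Z w)) as [level0 [level0_def level0_rec]].
{ apply (dterm_fun2 tower_def (dterm_var _ _) (dterm_const _)). }
set (level := level0 (empty M)).
assert (level_def : dterm (F := full_frame M) (fun _ e => level (e 0)))
  by exact (dterm_fun2 level0_def (dterm_const _) (dterm_var _ _)).
assert (level_rec : forall β, level β = tower (image level β) w)
  by (intros β; apply level0_rec).
assert (adm_level : forall β, β ∈ κ ->
  admissible κ N (image level β) /\ admissible κ N (level β))
  by exact (admissible_level hκ w_omega w_mem tower_def tower_empty in_tower
    level_def level_rec N_def N_below).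
apply (@iterated_truth_exists M κ w A hκ w_omega (admissible κ N)
  (in_stage T N)) with tower level; auto.
- intros t; now apply def_admissible.
- intros t t'; now apply def_in_stage.
- intros s t; apply admissible_mem.
(* The class variable of [f] is interpreted by [X], the union of the stages of the members of
   [t]. *)
- intros t p Ht; destruct (stage_class T N_def t) as [X HX].
  rewrite (in_stage_iff hκ HT N_def N_rec p Ht HX), Hf, HX.
  split; (intros [H|H]; [left|now right]); revert H; apply settles_mono;
    intros q; apply HX.
- intros β n Hβ Hn; apply (admissible_tower hκ tower_def tower_empty in_tower N_def N_below);
    [now apply adm_level|auto].
- intros β Hβ; now apply adm_level.
Qed.
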